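(* Let $K\in L_2(\mathbb R)$ be a kernel (satisfying the standing assumptions below) with $S_K=T_K$, and let $f\in L_2(\mathbb R)$ be a probability density. Then $\Phi(n,f,K)$ is of exact order $n^{-1}$ if and only if $S_K>0$ and $D_f<\infty$.
   Context: A kernel is an integrable function $K:\mathbb R\to\mathbb R$ with $\int K=1$; standing assumptions: $K$ is bounded, continuous at $0$, and $\int K^2<2K(0)$. For a sample $X_1,\dots,X_n$ i.i.d. with density $f$, bandwidth $h>0$, $f_{n,K,h}(x)=\frac1n\sum_{i=1}^n K_h(x-X_i)$ with $K_h(x)=K(x/h)/h$. $\mathrm{MISE}_f(f_{n,K,h})=E_f\int (f_{n,K,h}-f)^2$, and $\Phi(n,f,K)=\min_{h>0}\mathrm{MISE}_f(f_{n,K,h})$. $\varphi_K(t)=\int e^{itx}K(x)dx$ and $\varphi_f(t)=\int e^{itx}f(x)dx$. $S_K=\inf\{t\ge0: |\varphi_K(t)-1|\ne0\}$, $T_K=\inf\{r\ge0: |\varphi_K(t)-1|\ne0 \text{ for a.e. } t\ge r\}$, $D_f=\sup\{t\ge0:\varphi_f(t)\ne0\}$. ''Exact order $n^{-1}$'' means there exist $0<c\le C<\infty$ and $n_0$ with $c/n\le\Phi(n,f,K)\le C/n$ for all $n\ge n_0$. *)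

(* Defs.v *)
From HB Require Import structures.
From mathcomp Require Import all_boot all_order all_algebra.
From mathcomp Require Import all_classical all_reals all_analysis.
From mathcomp Require Import complex.
Set Implicit Arguments. Unset Strict Implicit. Unset Printing Implicit Defensive.
Import Order.TTheory GRing.Theory Num.Theory numFieldNormedType.Exports.
Local Open Scope classical_set_scope.
Local Open Scope ring_scope.

Section Defs.
Variable R : realType.
Local Notation leb := (@lebesgue_measure R).

Definition Kh (K : R -> R) (h : R) (x : R) : R := K (x / h) / h.

Definition kde (n : nat) (K : R -> R) (h : R) (X : seq R) (x : R) : R :=
  n%:R^-1 * \sum_(y <- X) Kh K h (x - y).

(* E_f[g(X_1,...,X_n)] for X_i i.i.d. with density f and g >= 0:
   the iterated Lebesgue integral  int ... int g(y_1..y_n) f(y_1)...f(y_n) dy_1...dy_n *)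
Fixpoint iid_expect (f : R -> R) (n : nat) (g : seq R -> \bar R) : \bar R :=
  match n with
  | 0 => g [::]
  | m.+1 => (\int[leb]_y ((f y)%:E * iid_expect f m (fun s => g (y :: s))))%E
  end.

Definition MISE (n : nat) (f K : R -> R) (h : R) : \bar R :=
  iid_expect f n (fun X => (\int[leb]_x (((kde n K h X x - f x) ^+ 2)%:E))%E).

Definition Phi (n : nat) (f K : R -> R) : \bar R :=
  ereal_inf [set MISE n f K h | h in [set h : R | 0 < h]].

Definition charfun (g : R -> R) (t : R) : R[i] :=
  ((Rintegral leb setT (fun x => cos (t * x) * g x)) +i*
   (Rintegral leb setT (fun x => sin (t * x) * g x)))%C.

Definition S_K (K : R -> R) : \bar R :=
  ereal_inf [set t%:E | t in [set t : R | 0 <= t /\ `|charfun K t - 1| != 0]].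

Definition T_K (K : R -> R) : \bar R :=
  ereal_inf [set r%:E | r in [set r : R | 0 <= r /\
     {ae leb, forall t, r <= t -> `|charfun K t - 1| != 0}]].

Definition D_f (f : R -> R) : \bar R :=
  ereal_sup [set t%:E | t in [set t : R | 0 <= t /\ charfun f t != 0]].

Definition is_kernel (K : R -> R) : Prop :=
  [/\ leb.-integrable setT (fun x => (K x)%:E),
      (\int[leb]_x (K x)%:E = 1)%E,
      (exists M : R, forall x, `|K x| <= M),
      {for (0:R), continuous K} &
      (\int[leb]_x (((K x) ^+ 2)%:E) < (2 * K 0)%:E)%E].

Definition L2 (g : R -> R) : Prop :=
  measurable_fun setT g /\ (\int[leb]_x (((g x) ^+ 2)%:E) < +oo)%E.

Definition prob_density (f : R -> R) : Prop :=
  [/\ measurable_fun setT f, (forall x, 0 <= f x) & (\int[leb]_x (f x)%:E = 1)%E].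

Definition exact_order_inv_n (u : nat -> \bar R) : Prop :=
  exists c C : R, [/\ 0 < c, c <= C &
    exists n0 : nat, forall n : nat, (n0 <= n)%N -> (0 < n)%N ->
      ((c / n%:R)%:E <= u n /\ u n <= (C / n%:R)%:E)%E].

End Defs.

(* Main.v *)
Require Import Defs.
From HB Require Import structures.
From mathcomp Require Import all_boot all_order all_algebra.
From mathcomp Require Import all_classical all_reals all_analysis.
From mathcomp Require Import complex.
From mathcomp Require Import measurable_realfun ring lra.
Import Order.TTheory GRing.Theory Num.Theory numFieldNormedType.Exports.
Local Open Scope ring_scope.

(** Write mu_h = K_h * f, B(h) = ||mu_h - f||^2 and
    W(h) = int_x Var (K_h (x - X_1)) dx.  Integrating out one observation at a
    time gives MISE = B(h) + W(h) / n.

    Always MISE >= c / n.  On the one hand mu_h is uniformly small for large h,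
    so B(h) is bounded below for h >= h_1.  On the other hand
    W(h) = ||K||^2 / h - ||mu_h||^2 tends to infinity as h -> 0, because
    ||mu_h|| <= ||K||_1 ||f|| (Young), and W (h / 2) <= 8 W (h), because 2 W(h)
    averages the squared L2 norms of increments of K_h over pairs of
    observations, and an increment of step 2s is a sum of two of step s.  So W
    is bounded below for h <= h_1.

    If S_K > 0 and D_f < oo, take h with h D_f < S_K: then
    phi_K(h t) phi_f(t) = phi_f(t) for all t, hence B(h) = 0 by uniqueness of
    Fourier transforms, and MISE = W(h) / n.

    Conversely, if Phi(n) = O(1/n), nearly optimal bandwidths h_n stay in a
    compact subset of (0, oo) and B(h_n) -> 0.  Along a subsequence h_n -> h > 0,
    and mu_(h_n) -> mu_h weakly, so mu_h = f, that is
    phi_K(h t) phi_f(t) = phi_f(t).  Thus phi_K(h t) = 1 wherever phi_f(t) is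
    nonzero.  This holds near t = 0, so S_K > 0.  If phi_K were 1 everywhere
    then B would vanish at every h, so T_K = S_K < oo, and as phi_K is a.e.
    different from 1 beyond T_K, the continuous function phi_f vanishes beyond
    T_K / h. *)

Set Implicit Arguments.
Unset Strict Implicit.
Unset Printing Implicit Defensive.

(** * Lebesgue integrals on the line *)

Section LebesgueAux.
Local Open Scope classical_set_scope.
Variable R : realType.
Local Notation leb := (@lebesgue_measure R).

Lemma measurable_affine (a b : R) :
  measurable_fun [set: measurableTypeR R] (fun x => a * x + b : measurableTypeR R).
Proof. by apply: measurable_funD => //; exact: measurable_funM. Qed.

(** Both sides are measures in [A], so comparing them on half-open intervals suffices; a negative
    [a] swaps which end of the preimage is closed, leaving its length unchanged. *)
Lemma lebesgue_affine (a b : R) (A : set (measurableTypeR R)) :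
  a != 0 -> measurable A ->
  (leb A = `|a|%:E * leb ((fun x : R => (a * x + b)%R) @^-1` A))%E.
Proof.
move=> a0 mA.
pose phi : measurableTypeR R -> measurableTypeR R := fun x => a * x + b.
have mphi : measurable_fun setT phi by exact: measurable_affine.
pose m := mscale (NngNum (normr_ge0 a)) (pushforward leb phi).
apply: (@lebesgue_measure_unique R (m mphi)) => //= _ [[u v]] _ <-.
rewrite /m /mscale/= /pushforward lebesgue_measure_itv/= lte_fin.
have [a_gt0|a_lt0|aE] := ltgtP 0 a; last by rewrite -aE eqxx in a0.
- rewrite (_ : _ @^-1` _ = `](u - b) / a, (v - b) / a]%classic); last first.
    apply/seteqP; split => x /=; rewrite !in_itv/= ltr_pdivrMr// ler_pdivlMr//;
      by rewrite /phi mulrC; lra.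
  rewrite lebesgue_measure_itv/= lte_fin ltr_pM2r ?invr_gt0// ltrD2r.
  case: ifPn => uv; last by rewrite mule0.
  by rewrite gtr0_norm// -EFinD -EFinM; congr (_%:E); field.
- rewrite (_ : _ @^-1` _ = `[(v - b) / a, (u - b) / a[%classic); last first.
    apply/seteqP; split => x /=; rewrite !in_itv/= ltr_ndivlMr// ler_ndivrMr//;
      by rewrite /phi mulrC; lra.
  rewrite lebesgue_measure_itv/= lte_fin ltr_nM2r ?invr_lt0// ltrD2r.
  case: ifPn => uv; last by rewrite mule0.
  by rewrite ltr0_norm// -EFinD -EFinM; congr (_%:E); field.
Qed.

Lemma ge0_integral_affine (a b : R) (F : R -> \bar R) : a != 0 ->
  measurable_fun setT F -> (forall x, 0 <= F x)%E ->
  (\int[leb]_x F x = `|a|%:E * \int[leb]_x F (a * x + b)%R)%E.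
Proof.
move=> a0 mF F0.
pose phi : measurableTypeR R -> measurableTypeR R := fun x => a * x + b.
have mphi : measurable_fun setT phi by exact: measurable_affine.
pose m := mscale (NngNum (normr_ge0 a)) (pushforward leb phi).
transitivity (\int[m mphi]_x F x)%E.
  by apply: eq_measure_integral => A mA _; exact: lebesgue_affine.
rewrite ge0_integral_mscale//= ge0_integral_pushforward//=.
Qed.

Lemma integrable_affine (a b : R) (F : R -> R) : a != 0 ->
  leb.-integrable setT (EFin \o F) ->
  leb.-integrable setT (EFin \o (fun x => F (a * x + b))).
Proof.
move=> a0 /integrableP[mF iF]; apply/integrableP; split.
  exact: (measurableT_comp mF (measurable_affine a b)).
have H : (\int[leb]_x `|(F x)%:E| = `|a|%:E * \int[leb]_x `|(F (a * x + b))%:E|)%E.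
  by apply: (@ge0_integral_affine a b (fun x => `|(F x)%:E|%E)) => //; exact: measurableT_comp.
rewrite ltey; apply/negP => /eqP E; move: iF.
by rewrite /= H E gt0_muley ?lte_fin ?normr_gt0// ltxx.
Qed.

Lemma integrableR_eq (f g : R -> R) : f =1 g ->
  leb.-integrable setT (EFin \o f) -> leb.-integrable setT (EFin \o g).
Proof. by move=> /funext ->. Qed.

Lemma integrableRZl (c : R) (f : R -> R) :
  leb.-integrable setT (EFin \o f) ->
  leb.-integrable setT (EFin \o (fun x => c * f x)).
Proof. by move=> fi; exact: (integrableZl measurableT c fi). Qed.

Lemma integrableRZr (c : R) (f : R -> R) :
  leb.-integrable setT (EFin \o f) ->
  leb.-integrable setT (EFin \o (fun x => f x * c)).
Proof.
by move=> /(integrableRZl c); apply: integrableR_eq => x; rewrite mulrC.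
Qed.

Lemma integrableRD (f g : R -> R) :
  leb.-integrable setT (EFin \o f) -> leb.-integrable setT (EFin \o g) ->
  leb.-integrable setT (EFin \o (fun x => f x + g x)).
Proof. by move=> fi gi; exact: (integrableD measurableT fi gi). Qed.

Lemma integrableRB (f g : R -> R) :
  leb.-integrable setT (EFin \o f) -> leb.-integrable setT (EFin \o g) ->
  leb.-integrable setT (EFin \o (fun x => f x - g x)).
Proof. by move=> fi gi; exact: (integrableB measurableT fi gi). Qed.

Lemma integrableR_measurable (f : R -> R) :
  leb.-integrable setT (EFin \o f) -> measurable_fun setT f.
Proof. by move=> fi; apply/measurable_EFinP; exact: measurable_int fi. Qed.

Lemma EFin_Rintegral (f : R -> R) : leb.-integrable setT (EFin \o f) ->
  (\int[leb]_x f x)%:E = (\int[leb]_x (f x)%:E)%E.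
Proof. by move=> fi; rewrite fineK//; exact: integrable_fin_num fi. Qed.

Lemma Rintegral_affine (a b : R) (F : R -> R) : a != 0 ->
  leb.-integrable setT (EFin \o F) ->
  Rintegral leb setT F = `|a| * Rintegral leb setT (fun x => F (a * x + b)).
Proof.
move=> a0 iF; have iG := integrable_affine b a0 iF.
rewrite /Rintegral -[X in X * _]/(fine `|a|%:E) -fineM//; last exact: integrable_fin_num.
congr fine; rewrite integralE [in RHS]integralE muleBr//; last first.
  by rewrite fin_num_adde_defr//; exact: integrable_pos_fin_num iG.
congr (_ - _)%E.
- rewrite (@ge0_integral_affine a b _ a0 (measurable_funepos (measurable_int _ iF))
    (funepos_ge0 _)).
  by congr (_ * _)%E; apply: eq_integral => x _; rewrite !funeposE.
- rewrite (@ge0_integral_affine a b _ a0 (measurable_funeneg (measurable_int _ iF))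
    (funeneg_ge0 _)).
  by congr (_ * _)%E; apply: eq_integral => x _; rewrite !funenegE.
Qed.

(** The integrable bound [B] on the slice norms gives joint integrability by Tonelli; integrability
    of every slice lets the inner real-valued integrals be read as extended ones. *)
Lemma Rintegral_fubini (G : R * R -> R) (B : R -> R) :
  measurable_fun setT G ->
  (forall x, leb.-integrable setT (EFin \o (fun y => G (x, y)))) ->
  (forall y, leb.-integrable setT (EFin \o (fun x => G (x, y)))) ->
  leb.-integrable setT (EFin \o B) ->
  (forall y, \int[leb]_x `|G (x, y)| <= B y) ->
  leb.-integrable setT (EFin \o (fun x => \int[leb]_y G (x, y))) /\
  \int[leb]_x \int[leb]_y G (x, y) = \int[leb]_y \int[leb]_x G (x, y).
Proof.
move=> mG Gx Gy iB GB.
have aGy y : leb.-integrable setT (EFin \o (fun x => `|G (x, y)|)) by exact: integrable_norm.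
have iG : (leb \x leb)%E.-integrable setT (EFin \o G).
  apply/integrable21ltyP => /=; first exact/measurable_EFinP.
  case/integrableP : iB => mB; apply: le_lt_trans.
  apply: ge0_le_integral => //.
  - by move=> y _; exact: integral_ge0.
  - apply: (measurable_fun_fubini_tonelli_G (m1 := leb) (fun z => `|G z|%:E)) => //.
    by apply/measurable_EFinP; exact: measurableT_comp.
  - exact: measurableT_comp.
  - move=> y _; rewrite -[leLHS]fineK; last exact: (integrable_fin_num _ (aGy y)).
    by rewrite lee_fin (le_trans (GB y))// ler_norm.
have Ex x := EFin_Rintegral (Gx x).
have Ey y := EFin_Rintegral (Gy y).
split.
- apply: eq_integrable (integrable_fubini_F iG) => // x _ /=.
  by rewrite Ex.
- rewrite [LHS]/Rintegral [RHS]/Rintegral; congr fine.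
  under eq_integral do rewrite Ex.
  under [RHS]eq_integral do rewrite Ey.
  exact: (Fubini iG).
Qed.

(** By Lebesgue differentiation [g] is almost everywhere the derivative of its primitive started at
    -n, which is constantly 0; the half-lines x > -n exhaust the line. *)
Lemma ae0_of_integral_itv0 (g : R -> R) :
  leb.-integrable setT (EFin \o g) ->
  (forall a b, a <= b -> Rintegral leb `[a, b] g = 0) ->
  {ae leb, forall x, g x = 0}.
Proof.
move=> ig g0.
have H n : {ae leb, forall x, - n%:R < x -> g x = 0}.
  have := @FTC1 R g (BLeft (- n%:R)).
  have iy y : leb.-integrable [set` Interval (BLeft (- n%:R)) (BRight y)] (EFin \o g).
    exact: integrableS ig.
  move=> /(_ iy).
  have lg : locally_integrable [set: R] g.
    by rewrite -(patch_setT (fun=> 0) g); exact: integrable_locally.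
  move=> /(_ lg); apply: filterS; first exact: (ae_filter_ringOfSetsType leb).
  move=> x /= H xn.
  have [_ <-] := H xn.
  rewrite (_ : (fun _ => _) = cst 0) ?derive1_cst//.
  apply/funext => y /=.
  have [ny|ny] := leP (- n%:R) y; first exact: g0.
  by rewrite set_itv_ge ?Rintegral_set0// bnd_simp -ltNge.
have /ae_foralln := H; apply: filterS.
move=> x /= Hx.
have [n xn] : exists n : nat, - x < n%:R.
  exists (Num.truncn `|x|).+1.
  by rewrite (le_lt_trans _ (truncnS_gt _))// -normrN ler_norm.
by apply: (Hx n); rewrite ltrNl.
Qed.

Lemma integrable_bounded (f g : R -> R) (M : R) :
  leb.-integrable setT (EFin \o f) -> measurable_fun setT g ->
  (forall x, `|g x| <= M) -> leb.-integrable setT (EFin \o (fun x => g x * f x)).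
Proof.
move=> fi mg gM.
apply: (@le_integrable _ _ _ leb setT _ _ (EFin \o (fun x => M * f x))) => //.
- apply/measurable_EFinP; apply: measurable_funM => //.
  exact: integrableR_measurable.
- move=> x _ /=; rewrite lee_fin !normrM ler_wpM2r//.
  by rewrite (le_trans (gM x))// ler_norm.
- exact: integrableRZl.
Qed.

Lemma Rintegral_cvg_ae (u : (R -> R)^nat) (v g : R -> R) :
  (forall n, measurable_fun setT (u n)) -> measurable_fun setT v ->
  {ae leb, forall x, u n x @[n --> \oo] --> v x} ->
  leb.-integrable setT (EFin \o g) ->
  (forall n x, `|u n x| <= g x) ->
  \int[leb]_x u n x @[n --> \oo] --> \int[leb]_x v x.
Proof.
move=> mu mv uv ig ug.
have [|||||iv _ cv] := @dominated_convergence _ _ R leb setT measurableT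
  (fun n => EFin \o u n) (EFin \o v) (EFin \o g).
- by move=> n; apply/measurable_EFinP; exact: mu.
- by apply/measurable_EFinP; exact: mv.
- move: uv; apply: filterS; first exact: (ae_filter_ringOfSetsType leb).
  move=> x uvx _; apply: cvg_EFin; last exact: uvx.
  exact: nearW.
- exact: ig.
- by apply: aeW => x n _ /=; rewrite lee_fin.
by apply: fine_cvg; rewrite fineK//; exact: integrable_fin_num iv.
Qed.

Lemma Rintegral_cvg (u : (R -> R)^nat) (v g : R -> R) :
  (forall n, measurable_fun setT (u n)) ->
  (forall x, u n x @[n --> \oo] --> v x) ->
  leb.-integrable setT (EFin \o g) ->
  (forall n x, `|u n x| <= g x) ->
  \int[leb]_x u n x @[n --> \oo] --> \int[leb]_x v x.
Proof.
move=> mu uv; apply: Rintegral_cvg_ae => //; last exact: aeW.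
by apply: (measurable_fun_cvg mu) => x _; exact: uv.
Qed.

End LebesgueAux.

(** * Convolution, translation invariance and Fubini *)

Section Convolution.
Local Open Scope classical_set_scope.
Variable R : realType.
Local Notation leb := (@lebesgue_measure R).

(** For [k = Kh K h] and a density [f], this is the mean of the estimator at [x]. *)
Definition conv (k f : R -> R) (x : R) : R := \int[leb]_y (k (x - y) * f y).

Definition sqnorm (g : R -> R) : \bar R := (\int[leb]_x (g x ^+ 2)%:E)%E.

Lemma sqnorm_ge0 g : (0 <= sqnorm g)%E.
Proof. by apply: integral_ge0 => x _; rewrite lee_fin sqr_ge0. Qed.

Lemma measurable_subr (k : R -> R) : measurable_fun setT k ->
  measurable_fun setT (fun z : R * R => k (z.1 - z.2)).
Proof.
move=> mk; apply: (measurableT_comp mk); apply: measurable_funB.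
- exact: measurable_fst.
- exact: measurable_snd.
Qed.

Lemma measurable_rsub (k : R -> R) (x : R) : measurable_fun setT k ->
  measurable_fun setT (fun y : R => k (x - y)).
Proof.
by move=> mk; apply: (measurableT_comp mk); exact: measurable_funB.
Qed.

Lemma integrable_shift (k : R -> R) (y : R) :
  leb.-integrable setT (EFin \o k) ->
  leb.-integrable setT (EFin \o (fun x => k (x - y))).
Proof.
move=> /(integrable_affine (- y) (oner_neq0 R)); apply: eq_integrable => // x _ /=.
by rewrite mul1r.
Qed.

Lemma Rintegral_shift (k : R -> R) (y : R) :
  leb.-integrable setT (EFin \o k) ->
  \int[leb]_x k (x - y) = \int[leb]_x k x.
Proof.
move=> ik; rewrite [RHS](Rintegral_affine (- y) (oner_neq0 R))// normr1 mul1r.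
by apply: eq_Rintegral => x _; rewrite mul1r.
Qed.

Lemma ge0_integral_shift (k : R -> \bar R) (y : R) : measurable_fun setT k ->
  (forall x, 0 <= k x)%E ->
  (\int[leb]_x k (x - y)%R = \int[leb]_x k x)%E.
Proof.
move=> mk k0; rewrite [RHS](ge0_integral_affine (- y) (oner_neq0 R))// normr1 mul1e.
by apply: eq_integral => x _; rewrite mul1r.
Qed.

(** The slice norms in [x] are at most [C] times ||k||_1 times |f y|, by translation invariance.
    Testing against [g] serves for integrability ([g = 1]), for Fourier transforms and for weak
    limits. *)
Lemma conv_fubini (k f g : R -> R) (M C : R) :
  leb.-integrable setT (EFin \o k) -> leb.-integrable setT (EFin \o f) ->
  measurable_fun setT g -> (forall x, `|k x| <= M) -> (forall x, `|g x| <= C) ->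
  leb.-integrable setT (EFin \o (fun x => g x * conv k f x)) /\
  \int[leb]_x (g x * conv k f x) =
  \int[leb]_y ((\int[leb]_x (g x * k (x - y))) * f y).
Proof.
move=> ik if_ mg kM gC.
have mk := integrableR_measurable ik; have mf := integrableR_measurable if_.
have C0 : 0 <= C by rewrite (le_trans _ (gC 0)).
have ikf x : leb.-integrable setT (EFin \o (fun y => k (x - y) * f y)).
  by apply: (@integrable_bounded _ _ _ M) => //; exact: measurable_rsub.
have igk y : leb.-integrable setT (EFin \o (fun x => g x * k (x - y))).
  by apply: (@integrable_bounded _ _ _ C) => //; exact: integrable_shift.
pose G (z : R * R) := g z.1 * (k (z.1 - z.2) * f z.2).
have iGy y : leb.-integrable setT (EFin \o (fun x => G (x, y))).
  by apply: integrableR_eq (integrableRZr (f y) (igk y)) => x; rewrite /G/= mulrA.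
have := @Rintegral_fubini R G (fun y => (C * \int[leb]_x `|k x|) * `|f y|).
case.
- apply: measurable_funM; first exact: (measurableT_comp mg measurable_fst).
  apply: measurable_funM; first exact: measurable_subr.
  exact: (measurableT_comp mf measurable_snd).
- by move=> x; exact: (integrableRZl (g x) (ikf x)).
- exact: iGy.
- exact: integrableRZl (integrable_norm if_).
- move=> y.
  rewrite -(Rintegral_shift y (integrable_norm ik)) mulrAC -RintegralZl//; last first.
    exact: integrable_shift (integrable_norm ik).
  apply: le_Rintegral => //.
  + exact: integrable_norm (iGy y).
  + by apply: integrableRZl; exact: integrable_shift (integrable_norm ik).
  + move=> x _; rewrite !normrM (mulrC `|k _|) mulrA ler_wpM2r// ler_wpM2r//.
move=> iGx E; split.
  apply: eq_integrable iGx => // x _ /=.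
  by rewrite /G/= RintegralZl.
rewrite /G/= in E.
transitivity (\int[leb]_x \int[leb]_y (g x * (k (x - y) * f y))).
  by apply: eq_Rintegral => x _; rewrite RintegralZl.
rewrite E; apply: eq_Rintegral => y _; rewrite -RintegralZr//.
by apply: eq_Rintegral => x _; rewrite mulrA.
Qed.

Lemma conv_integrable (k f : R -> R) (M : R) :
  leb.-integrable setT (EFin \o k) -> leb.-integrable setT (EFin \o f) ->
  (forall x, `|k x| <= M) -> leb.-integrable setT (EFin \o conv k f).
Proof.
move=> ik if_ kM.
have g1 (x : R) : `|cst (1 : R) x| <= 1 :> R by rewrite /= normr1.
have [+ _] := @conv_fubini k f (cst 1) M 1 ik if_ (measurable_cst _) kM g1.
by apply: integrableR_eq => x; rewrite /= mul1r.
Qed.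

End Convolution.

(** * The mean integrated squared error *)

Section MeanSquare.
Local Open Scope classical_set_scope.
Variable R : realType.
Local Notation leb := (@lebesgue_measure R).
Variables (k f : R -> R) (M : R).
Hypothesis ik : leb.-integrable setT (EFin \o k).
Hypothesis kM : forall x, `|k x| <= M.
Hypothesis df : prob_density f.

Let mk : measurable_fun setT k := integrableR_measurable ik.
Let mf : measurable_fun setT f. Proof. by case: df. Qed.
Let f0 x : 0 <= f x. Proof. by case: df. Qed.

Lemma density_integrable : leb.-integrable setT (EFin \o f).
Proof.
case: df => _ _ f1; apply/integrableP; split; first exact/measurable_EFinP.
under eq_integral do rewrite /= ger0_norm//.
by rewrite f1 ltry.
Qed.
Let if_ := density_integrable.

Lemma density_Rintegral : \int[leb]_x f x = 1.
Proof. by case: df => _ _ f1; rewrite /Rintegral f1. Qed.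

(** The variance of k (x - Y) for an observation Y with density [f]. *)
Definition var (x : R) : R := \int[leb]_y ((k (x - y) - conv k f x) ^+ 2 * f y).

Let ibf (u : R -> R) (C : R) : measurable_fun setT u -> (forall y, `|u y| <= C) ->
  leb.-integrable setT (EFin \o (fun y => u y * f y)).
Proof. by move=> mu uC; exact: integrable_bounded uC. Qed.

Let ikf x : leb.-integrable setT (EFin \o (fun y => k (x - y) * f y)).
Proof. by apply: (@ibf _ M) => //; exact: measurable_rsub. Qed.

Let ivar x : leb.-integrable setT (EFin \o
  (fun y => (k (x - y) - conv k f x) ^+ 2 * f y)).
Proof.
apply: (@ibf _ ((M + `|conv k f x|) ^+ 2)).
  apply: measurable_funX; apply: measurable_funB => //; exact: measurable_rsub.
move=> y; rewrite normrX lerXn2r ?nnegrE//; last first.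
  by rewrite (le_trans (ler_normB _ _))// lerD2r.
by rewrite addr_ge0// (le_trans _ (kM 0)).
Qed.

Lemma var_ge0 x : 0 <= var x.
Proof. by apply: Rintegral_ge0 => y _; rewrite mulr_ge0// sqr_ge0. Qed.

(** Expand the square around the mean: the cross term integrates to 0. The free offset [d] will hold
    the contribution of the other observations. *)
Lemma second_moment (d a x : R) :
  (\int[leb]_y ((f y)%:E * ((d + a * k (x - y)) ^+ 2)%:E) =
   ((d + a * conv k f x) ^+ 2 + a ^+ 2 * var x)%:E)%E.
Proof.
set m := conv k f x.
have i1 : leb.-integrable setT (EFin \o (fun y => (d + a * m) ^+ 2 * f y)).
  exact: integrableRZl.
have i2 : leb.-integrable setT (EFin \o (fun y => k (x - y) * f y - m * f y)).
  by apply: integrableRB => //; exact: integrableRZl.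
have i2' : leb.-integrable setT (EFin \o (fun y => (2 * a * (d + a * m)) *
    (k (x - y) * f y - m * f y))).
  exact: integrableRZl.
have i3 := integrableRZl (a ^+ 2) (ivar x).
transitivity (\int[leb]_y (((d + a * m) ^+ 2 * f y + (2 * a * (d + a * m)) *
    (k (x - y) * f y - m * f y)) + a ^+ 2 * ((k (x - y) - m) ^+ 2 * f y))%:E)%E.
  by apply: eq_integral => y _; rewrite -EFinM; congr EFin; ring.
rewrite -EFin_Rintegral; last by apply: integrableRD => //; exact: integrableRD.
congr EFin; rewrite RintegralD//; last exact: integrableRD.
rewrite RintegralD// !RintegralZl// density_Rintegral mulr1.
rewrite RintegralB//; last exact: integrableRZl.
by rewrite RintegralZl// density_Rintegral mulr1 -/(conv k f x) -/m subrr mulr0 addr0.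
Qed.

Let mconv : measurable_fun setT (conv k f).
Proof. exact: integrableR_measurable (conv_integrable ik if_ kM). Qed.

Lemma measurable_density_sqr (d : R -> R) (a : R) : measurable_fun setT d ->
  measurable_fun setT (fun z : R * R => ((f z.2)%:E * ((d z.1 + a * k (z.1 - z.2)) ^+ 2)%:E)%E).
Proof.
move=> md; apply: emeasurable_funM; apply/measurable_EFinP.
  exact: (measurableT_comp mf measurable_snd).
apply: measurable_funX; apply: measurable_funD.
  exact: (measurableT_comp md measurable_fst).
by apply: measurable_funM => //; exact: measurable_subr.
Qed.

(** Tonelli makes the second moment measurable in [x]; the squared mean is then subtracted. *)
Lemma measurable_var : measurable_fun setT var.
Proof.
have : measurable_fun setT (fun x => ((conv k f x ^+ 2 + var x)%:E)).
  rewrite (_ : (fun _ => _) =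
      fun x => (\int[leb]_y ((f y)%:E * ((cst 0 x + 1 * k (x - y)) ^+ 2)%:E))%E); last first.
    by apply/funext => x; rewrite second_moment/= add0r expr1n !mul1r.
  apply: (measurable_fun_fubini_tonelli_F (m2 := leb)
    (fun z : R * R => ((f z.2)%:E * ((cst 0 z.1 + 1 * k (z.1 - z.2)) ^+ 2)%:E)%E)).
    exact: measurable_density_sqr.
  by move=> z; rewrite mule_ge0 ?lee_fin ?sqr_ge0.
move=> /measurable_EFinP H.
rewrite (_ : var = fun x => (conv k f x ^+ 2 + var x) - conv k f x ^+ 2).
  by apply: measurable_funB => //; exact: measurable_funX.
by apply/funext => x; rewrite addrC addKr.
Qed.

(** The integrated variance of a single observation, W(h) when [k = Kh K h]. *)
Definition totvar : \bar R := (\int[leb]_x (var x)%:E)%E.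

Lemma totvar_ge0 : (0 <= totvar)%E.
Proof. by apply: integral_ge0 => x _; rewrite lee_fin var_ge0. Qed.

(** Tonelli moves the expectation inside the integral over [x], where [second_moment] applies
    pointwise. *)
Lemma expect_sqnorm1 (d : R -> R) (a : R) : measurable_fun setT d ->
  (\int[leb]_y ((f y)%:E * sqnorm (fun x => (d x + a * k (x - y))%R)) =
   sqnorm (fun x => (d x + a * conv k f x)%R) + (a ^+ 2)%:E * totvar)%E.
Proof.
move=> md.
pose G (z : R * R) := ((f z.2)%:E * ((d z.1 + a * k (z.1 - z.2)) ^+ 2)%:E)%E.
have mG : measurable_fun setT G by exact: measurable_density_sqr.
have G0 z : (0 <= G z)%E by rewrite mule_ge0 ?lee_fin ?sqr_ge0.
transitivity (\int[leb]_y \int[leb]_x G (x, y))%E.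
  apply: eq_integral => y _; rewrite -ge0_integralZl//.
  - apply/measurable_EFinP; apply: measurable_funX; apply: measurable_funD => //.
    by apply: measurable_funM => //; apply: (measurableT_comp mk); exact: measurable_funB.
  - by move=> x _; rewrite lee_fin sqr_ge0.
  - by rewrite lee_fin.
rewrite -(fubini_tonelli (m1 := leb) (m2 := leb) G)//.
under eq_integral do rewrite /G/= second_moment EFinD (EFinM (a ^+ 2)).
have ms : measurable_fun setT (fun x => d x + a * conv k f x).
  by apply: measurable_funD => //; exact: measurable_funM.
rewrite ge0_integralD//.
- rewrite ge0_integralZl//.
  + by apply/measurable_EFinP; exact: measurable_var.
  + by move=> x _; rewrite lee_fin var_ge0.
  + by rewrite lee_fin sqr_ge0.
- by move=> x _; rewrite lee_fin sqr_ge0.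
- by apply/measurable_EFinP; exact: measurable_funX.
- by move=> x _; rewrite mule_ge0 ?lee_fin ?sqr_ge0 ?var_ge0.
- apply: emeasurable_funM => //.
  by apply/measurable_EFinP; exact: measurable_var.
Qed.

(** Induction on the sample size with [c] general: the first observation is absorbed into [c], the
    induction hypothesis averages out the others, and [expect_sqnorm1] then averages out the
    first. *)
Lemma iid_expect_sqnorm (n : nat) (c : R -> R) (a : R) : measurable_fun setT c ->
  (iid_expect f n (fun X => sqnorm (fun x => (c x + a * \sum_(y <- X) k (x - y))%R)) =
   sqnorm (fun x => (c x + a * (n%:R * conv k f x))%R) +
   (n%:R * a ^+ 2)%:E * totvar)%E.
Proof.
elim: n c => [|n IH] c mc /=.
  rewrite mul0r mul0e adde0; congr sqnorm; apply/funext => x.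
  by rewrite big_nil mul0r.
have mck y : measurable_fun setT (fun x => c x + a * k (x - y)).
  apply: measurable_funD => //; apply: measurable_funM => //.
  by apply: (measurableT_comp mk); exact: measurable_funB.
transitivity (\int[leb]_y ((f y)%:E * sqnorm (fun x => (c x + a * (n%:R * conv k f x)) + a * k (x - y))%R
    + (f y)%:E * ((n%:R * a ^+ 2)%:E * totvar)))%E.
  apply: eq_integral => y _.
  rewrite -muleDr; last 2 first.
  - by [].
  - by apply: ge0_adde_def; rewrite inE ?sqnorm_ge0// mule_ge0 ?totvar_ge0// lee_fin mulr_ge0 ?sqr_ge0.
  congr (_ * _)%E.
  transitivity (iid_expect f n (fun X => sqnorm (fun x =>
      ((c x + a * k (x - y)) + a * \sum_(z <- X) k (x - z))%R))).
    congr iid_expect; apply/funext => X; congr sqnorm; apply/funext => x.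
    by rewrite big_cons mulrDr addrA.
  rewrite IH//; congr (sqnorm _ + _)%E; apply/funext => x; ring.
set d := fun x : R => c x + a * (n%:R * conv k f x).
have md : measurable_fun setT d.
  by apply: measurable_funD => //; apply: measurable_funM => //; exact: measurable_funM.
have tv0 : (0 <= (n%:R * a ^+ 2)%:E * totvar)%E.
  by rewrite mule_ge0 ?totvar_ge0// lee_fin mulr_ge0 ?sqr_ge0.
rewrite ge0_integralD//; last 4 first.
- by move=> y _; rewrite mule_ge0 ?lee_fin ?sqnorm_ge0.
- apply: emeasurable_funM; first exact/measurable_EFinP.
  apply: (measurable_fun_fubini_tonelli_G (m1 := leb)
    (fun z : R * R => (((d z.1 + a * k (z.1 - z.2)) ^+ 2)%:E)%E)).
    apply/measurable_EFinP; apply: measurable_funX; apply: measurable_funD.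
      exact: (measurableT_comp md measurable_fst).
    by apply: measurable_funM => //; exact: measurable_subr.
  by move=> z; rewrite lee_fin sqr_ge0.
- by move=> y _; rewrite mule_ge0 ?lee_fin.
- by apply: emeasurable_funM => //; exact/measurable_EFinP.
rewrite expect_sqnorm1// ge0_integralZr//; last 2 first.
- exact/measurable_EFinP.
- by move=> y _; rewrite lee_fin.
case: df => _ _ ->; rewrite mul1e -addeA; congr (_ + _)%E.
  by congr sqnorm; apply/funext => x; rewrite /d -natr1; ring.
have -> : n.+1%:R * a ^+ 2 = a ^+ 2 + n%:R * a ^+ 2 by rewrite -natr1; ring.
by rewrite EFinD ge0_muleDl// lee_fin; [exact: sqr_ge0|rewrite mulr_ge0 ?sqr_ge0].
Qed.

(* Variance is second moment minus squared mean, integrated over x. *)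
Lemma totvarE : (totvar + sqnorm (conv k f) = sqnorm k)%E.
Proof.
have := @expect_sqnorm1 (cst 0) 1 (measurable_cst _).
rewrite /= expr1n mul1e addeC.
rewrite (_ : (fun x => 0 + 1 * conv k f x) = conv k f); last first.
  by apply/funext => x; rewrite add0r mul1r.
move=> <-; transitivity (\int[leb]_y ((f y)%:E * sqnorm k))%E.
  apply: eq_integral => y _; congr (_ * _)%E.
  rewrite /sqnorm -[RHS](ge0_integral_shift y)//.
  - by apply: eq_integral => x _; rewrite add0r mul1r.
  - by apply/measurable_EFinP; exact: measurable_funX.
  - by move=> x; rewrite lee_fin sqr_ge0.
rewrite ge0_integralZr ?sqnorm_ge0//; last 2 first.
- exact/measurable_EFinP.
- by move=> y _; rewrite lee_fin.
by case: df => _ _ ->; rewrite mul1e.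
Qed.

(* Young's inequality; pointwise, 2 l f <= f^2 + l^2 is integrated against |k (x - y)|
    and l is optimized. *)
Lemma sqnorm_conv_le (kappa : R) : \int[leb]_x `|k x| <= kappa -> 0 < kappa ->
  (sqnorm (conv k f) <= (kappa ^+ 2)%:E * sqnorm f)%E.
Proof.
move=> kk kappa0.
pose q x := (\int[leb]_y (`|k (x - y)| * f y ^+ 2)%:E)%E.
have mka : measurable_fun setT (fun x => `|k x|) by exact: measurableT_comp.
have mq2 : measurable_fun setT (fun z : R * R => (`|k (z.1 - z.2)| * f z.2 ^+ 2)%:E).
  apply/measurable_EFinP; apply: measurable_funM.
    exact: (measurable_subr mka).
  by apply: measurable_funX; exact: (measurableT_comp mf measurable_snd).
have q20 (z : R * R) : (0 <= (`|k (z.1 - z.2)| * f z.2 ^+ 2)%:E)%E.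
  by rewrite lee_fin mulr_ge0 ?sqr_ge0.
have iak := integrable_norm ik.
have pt x : ((conv k f x ^+ 2)%:E <= kappa%:E * q x)%E.
  pose m := \int[leb]_y (`|k (x - y)| * f y).
  have iakf : leb.-integrable setT (EFin \o (fun y => `|k (x - y)| * f y)).
    by apply: integrableR_eq (integrable_norm (ikf x)) => y /=; rewrite normrM (ger0_norm (f0 _)).
  have iakr : leb.-integrable setT (EFin \o (fun y => `|k (x - y)|)).
    apply: integrableR_eq (integrable_affine x (_ : -1 != 0) iak) => [y|].
      by rewrite mulN1r addrC.
    by rewrite oppr_eq0 oner_neq0.
  have kkx : \int[leb]_y `|k (x - y)| <= kappa.
    rewrite (le_trans _ kk)// [leRHS](Rintegral_affine x (_ : -1 != 0))// ?oppr_eq0 ?oner_neq0//.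
    rewrite normrN1 mul1r le_eqVlt; apply/orP; left; apply/eqP.
    by apply: eq_Rintegral => y _; rewrite mulN1r addrC.
  have m0 : 0 <= m by apply: Rintegral_ge0 => y _; rewrite mulr_ge0.
  have cm : conv k f x ^+ 2 <= m ^+ 2.
    rewrite -(real_normK (num_real (conv k f x))) lerXn2r ?nnegrE//.
    rewrite (le_trans (le_normr_Rintegral _ (ikf x)))//.
    apply: le_Rintegral => //; first exact: integrable_norm.
    by move=> y _; rewrite normrM (ger0_norm (f0 _)).
  rewrite (@le_trans _ _ (m ^+ 2)%:E)//.
  (* The maximizer of 2 l m - l^2 kappa, whose value there is m^2 / kappa. *)
  pose l := m / kappa.
  have l0 : 0 <= l by apply: divr_ge0 => //; exact: ltW.
  have H : ((2 * l * m)%:E <= q x + (l ^+ 2 * kappa)%:E)%E.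
    rewrite (@le_trans _ _ (q x + (\int[leb]_y (l ^+ 2 * `|k (x - y)|)%:E))%E)//; last first.
      rewrite leeD2l// -EFin_Rintegral ?lee_fin; last exact: integrableRZl.
      by rewrite RintegralZl// ler_wpM2l// sqr_ge0.
    rewrite -ge0_integralD//; last 4 first.
    - by move=> y _; exact: (q20 (x, y)).
    - exact: (measurable_fun_pair2 x mq2).
    - by move=> y _; rewrite lee_fin mulr_ge0 ?sqr_ge0.
    - apply/measurable_EFinP; apply: measurable_funM => //.
      exact: (measurable_rsub x mka).
    rewrite /m -RintegralZl// EFin_Rintegral; last exact: integrableRZl.
    apply: ge0_le_integral => //.
    - by move=> y _; rewrite lee_fin; do 2 apply: mulr_ge0 => //.
    - by apply/measurable_EFinP; exact: integrableR_measurable (integrableRZl _ iakf).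
    - apply: emeasurable_funD; first exact: (measurable_fun_pair2 x mq2).
      apply/measurable_EFinP; apply: measurable_funM => //.
      exact: (measurable_rsub x mka).
    - move=> y _; rewrite -EFinD lee_fin.
      have := sqr_ge0 (f y - l) => s0.
      rewrite -subr_ge0 (_ : _ - _ = `|k (x - y)| * (f y - l) ^+ 2); last by ring.
      by rewrite mulr_ge0.
  have -> : (m ^+ 2)%:E = (kappa%:E * ((2 * l * m)%:E - (l ^+ 2 * kappa)%:E))%E.
    by rewrite -EFinB -EFinM /l; congr EFin; field; rewrite gt_eqF.
  apply: lee_wpmul2l; first by rewrite lee_fin ltW.
  by rewrite leeBlDr.
rewrite /sqnorm (@le_trans _ _ (\int[leb]_x (kappa%:E * q x))%E)//.
  apply: ge0_le_integral => //.
  - by move=> x _; rewrite lee_fin sqr_ge0.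
  - by apply/measurable_EFinP; exact: measurable_funX.
  - by apply: emeasurable_funM => //; exact: (measurable_fun_fubini_tonelli_F (m2 := leb) _ mq2).
have mq : measurable_fun setT q by exact: (measurable_fun_fubini_tonelli_F (m2 := leb) _ mq2).
have q0 x : (0 <= q x)%E by apply: integral_ge0 => y _; exact: (q20 (x, y)).
have kE : (0 <= kappa%:E)%E by rewrite lee_fin ltW.
rewrite ge0_integralZl//.
(* One factor [kappa] comes from the pointwise bound; after Tonelli, integrating |k (x - y)| over
   [x] supplies the other. *)
rewrite expr2 EFinM -muleA; apply: lee_wpmul2l => //; rewrite /q.
rewrite (fubini_tonelli (m1 := leb) (m2 := leb) _ mq2)//=.
rewrite -ge0_integralZl//; last 2 first.
- by apply/measurable_EFinP; exact: measurable_funX.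
- by move=> x _; rewrite lee_fin sqr_ge0.
apply: ge0_le_integral => //.
- by move=> y _; apply: integral_ge0 => x _; exact: (q20 (x, y)).
- exact: (measurable_fun_fubini_tonelli_G (m1 := leb) _ mq2).
- by apply: emeasurable_funM => //; apply/measurable_EFinP; exact: measurable_funX.
move=> y _; have ish := integrable_shift y iak.
rewrite -EFin_Rintegral; last exact: integrableRZr.
rewrite RintegralZr// -EFinM lee_fin ler_wpM2r ?sqr_ge0//.
by rewrite (Rintegral_shift y iak).
Qed.

(* Twice a variance is the mean squared difference of two independent copies. *)
Lemma totvar_pairs : (totvar + totvar = \int[leb]_y ((f y)%:E *
  \int[leb]_z ((f z)%:E * sqnorm (fun x => (k (x - y) - k (x - z))%R))))%E.
Proof.
have mky (y : R) : measurable_fun setT (fun x : R => k (x - y)).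
  by apply: (measurableT_comp mk); exact: measurable_funB.
(* For fixed [y], averaging over [z] gives the squared distance of k (x - y) to its mean plus the
   variance; averaging that distance over [y] gives the variance again. *)
transitivity (\int[leb]_y ((f y)%:E * sqnorm (fun x => (- conv k f x + 1 * k (x - y))%R) +
   (f y)%:E * totvar))%E.
  rewrite ge0_integralD//; last 4 first.
  - by move=> y _; rewrite mule_ge0 ?lee_fin ?sqnorm_ge0.
  - apply: emeasurable_funM; first exact/measurable_EFinP.
    apply: (measurable_fun_fubini_tonelli_G (m1 := leb)
      (fun z : R * R => (((- conv k f z.1 + 1 * k (z.1 - z.2)) ^+ 2)%:E)%E)).
      apply/measurable_EFinP; apply: measurable_funX; apply: measurable_funD.
        apply: measurable_funN; exact: (measurableT_comp mconv measurable_fst).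
      by apply: measurable_funM => //; exact: measurable_subr.
    by move=> z; rewrite lee_fin sqr_ge0.
  - by move=> y _; rewrite mule_ge0 ?lee_fin ?totvar_ge0.
  - by apply: emeasurable_funM => //; exact/measurable_EFinP.
  rewrite (@expect_sqnorm1 (fun x => - conv k f x)); last exact: measurable_funN.
  rewrite ge0_integralZr ?totvar_ge0//; last 2 first.
  - exact/measurable_EFinP.
  - by move=> y _; rewrite lee_fin.
  case: df => _ _ ->; rewrite mul1e expr1n mul1e.
  rewrite (_ : sqnorm _ = 0%E) ?add0e//.
  rewrite /sqnorm; under eq_integral do rewrite mul1r addNr expr0n/=.
  by rewrite integral0.
apply: eq_integral => y _.
rewrite -ge0_muleDr ?sqnorm_ge0 ?totvar_ge0//; congr (_ * _)%E.
transitivity (\int[leb]_z ((f z)%:E * sqnorm (fun x => (k (x - y) + (-1) * k (x - z))%R)))%E.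
  rewrite expect_sqnorm1// sqrrN expr1n mul1e; congr (sqnorm _ + _)%E.
  by apply/funext => x; ring.
apply: eq_integral => z _; congr (_ * sqnorm _)%E.
by apply/funext => x; ring.
Qed.

End MeanSquare.

(** * Halving the bandwidth multiplies the integrated variance by at most 8 *)

Section Halving.
Local Open Scope classical_set_scope.
Variable R : realType.
Local Notation leb := (@lebesgue_measure R).

Lemma lee_of_double (c : R) (s t : \bar R) : (0 <= t)%E ->
  (s + s <= c%:E * (t + t))%E -> (s <= c%:E * t)%E.
Proof.
move=> t0 st; rewrite leNgt; apply/negP => ts; have := lteD ts ts.
by rewrite -ge0_muleDr// => /(le_lt_trans st); rewrite ltxx.
Qed.

(* After rescaling, the increment of step 2 (y - z) is split at its midpoint. *)
Lemma sqnorm_increment_half (k k2 : R -> R) (y z : R) : measurable_fun setT k ->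
  (forall x, k2 x = 2 * k (2 * x)) ->
  (sqnorm (fun x => (k2 (x - y) - k2 (x - z))%R) <=
   8%:E * sqnorm (fun x => (k (x - y) - k (x - z))%R))%E.
Proof.
move=> mk k2E.
have mkd (u v : R) : measurable_fun setT (fun x : R => ((k (x - u) - k (x - v)) ^+ 2)%:E).
  apply/measurable_EFinP; apply: measurable_funX; apply: measurable_funB;
  by apply: (measurableT_comp mk); exact: measurable_funB.
have kd0 (u v x : R) : (0 <= ((k (x - u) - k (x - v)) ^+ 2)%:E)%E by rewrite lee_fin sqr_ge0.
pose D u v := sqnorm (fun x => k (x - u) - k (x - v)).
have D0 u v : (0 <= D u v)%E by exact: sqnorm_ge0.
have Dshift c u v : D (u + c) (v + c) = D u v.
  rewrite /D /sqnorm -[RHS](ge0_integral_shift c)//.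
  by apply: eq_integral => x _; rewrite !(addrC _ c) !opprD !addrA.
(* Squaring the factor 2 of [k2] gives 4, of which the substitution of 2 x takes away a factor 2. *)
have -> : sqnorm (fun x => k2 (x - y) - k2 (x - z)) = (2%:E * D (2 * y)%R (2 * z)%R)%E.
  rewrite {1}/sqnorm /D /sqnorm [in RHS](ge0_integral_affine 0 (_ : 2 != 0))//.
  rewrite muleA -EFinM ger0_norm// -ge0_integralZl//; last first.
    exact: (measurableT_comp (mkd _ _) (measurable_affine 2 0)).
  apply: eq_integral => x _; rewrite !k2E -EFinM; congr EFin.
  by rewrite addr0 !mulrBr; ring.
have : (D (2 * y)%R (2 * z)%R <= 4%:E * D y z)%E; last first.
  move=> H; rewrite (_ : 8 = 2 * 4 :> R); last by ring.
  by rewrite EFinM -muleA lee_wpmul2l.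
(* The midpoint [y + z] splits the increment into two translates of the increment from [y] to [z];
   what remains is (a - c)^2 <= 2 (a - b)^2 + 2 (b - c)^2 under the integral. *)
have -> : (4%:E * D y z = 2%:E * D (2 * y)%R (y + z)%R + 2%:E * D (y + z)%R (2 * z)%R)%E.
  have -> : 2 * y = y + y by ring.
  have -> : 2 * z = z + z by ring.
  have -> : D (y + y) (y + z) = D y z by rewrite ![y + _]addrC Dshift.
  rewrite Dshift (_ : 4 = 2 + 2 :> R); last by ring.
  by rewrite EFinD ge0_muleDl.
have DZ u v : (2%:E * D u v =
    \int[leb]_x (2%:E * ((k (x - u) - k (x - v)) ^+ 2)%:E))%E.
  rewrite ge0_integralZl//; try exact: mkd; try by rewrite lee_fin.
have mkd2 u v : measurable_fun setT (fun x : R => (2%:E * ((k (x - u) - k (x - v)) ^+ 2)%:E)%E).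
  by apply: emeasurable_funM; [exact: measurable_cst|exact: mkd].
rewrite !DZ -ge0_integralD//; last 4 first.
- by move=> x _; rewrite mule_ge0.
- exact: mkd2.
- by move=> x _; rewrite mule_ge0.
- exact: mkd2.
apply: ge0_le_integral => //.
- exact: mkd.
- by apply: emeasurable_funD; exact: mkd2.
- move=> x _; rewrite -!EFinM -EFinD lee_fin.
  set a := k (x - 2 * y); set b := k (x - (y + z)); set c := k (x - 2 * z).
  have := sqr_ge0 (a - b - (b - c)) => s0.
  rewrite -subr_ge0 (_ : _ - _ = (a - b - (b - c)) ^+ 2)//; ring.
Qed.

(** By [totvar_pairs] both variances, doubled, average increments over the same pairs of
    observations, so the bound for each pair carries over. *)
Lemma totvar_half (k k2 f : R -> R) (M : R) :
  leb.-integrable setT (EFin \o k) -> (forall x, `|k x| <= M) ->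
  leb.-integrable setT (EFin \o k2) -> (forall x, `|k2 x| <= 2 * M) ->
  prob_density f ->
  (forall x, k2 x = 2 * k (2 * x)) ->
  (totvar k2 f <= 8%:E * totvar k f)%E.
Proof.
move=> ik kM ik2 k2M df k2E.
have mk := integrableR_measurable ik; have mk2 := integrableR_measurable ik2.
have [mf f0 _] := df.
have mS (q : R -> R) : measurable_fun setT q -> measurable_fun setT
    (fun u : R * R => (f u.2)%:E * sqnorm (fun x => (q (x - u.1) - q (x - u.2))%R))%E.
  move=> mq; apply: emeasurable_funM.
    by apply/measurable_EFinP; exact: (measurableT_comp mf measurable_snd).
  apply: (measurable_fun_fubini_tonelli_F (m2 := leb)
      (fun z : (R * R) * R => (((q (z.2 - z.1.1) - q (z.2 - z.1.2)) ^+ 2)%:E)%E)).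
    apply/measurable_EFinP; apply: measurable_funX; apply: measurable_funB;
    apply: (measurableT_comp mq); apply: measurable_funB.
    - exact: measurable_snd.
    - exact: (measurableT_comp measurable_fst measurable_fst).
    - exact: measurable_snd.
    - exact: (measurableT_comp measurable_snd measurable_fst).
  by move=> z; rewrite lee_fin sqr_ge0.
have S0 (q : R -> R) (u : R * R) :
    (0 <= (f u.2)%:E * sqnorm (fun x => (q (x - u.1) - q (x - u.2))%R))%E.
  by rewrite mule_ge0 ?lee_fin ?sqnorm_ge0.
have mI (q : R -> R) : measurable_fun setT q -> measurable_fun setT
    (fun y => (f y)%:E * \int[leb]_z ((f z)%:E * sqnorm (fun x => (q (x - y) - q (x - z))%R)))%E.
  move=> mq; apply: emeasurable_funM; first exact/measurable_EFinP.
  exact: (measurable_fun_fubini_tonelli_F (m2 := leb) _ (mS q mq)).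
have I0 (q : R -> R) y : (0 <= \int[leb]_z ((f z)%:E * sqnorm (fun x => (q (x - y) - q (x - z))%R)))%E.
  by apply: integral_ge0 => z _; exact: (S0 q (y, z)).
suff : (totvar k2 f + totvar k2 f <= 8%:E * (totvar k f + totvar k f))%E.
  by apply: lee_of_double; exact: totvar_ge0.
move: (totvar_pairs ik2 k2M df) (totvar_pairs ik kM df).
move: (totvar k2 f) (totvar k f) => t2 t E2 E; rewrite {t2}E2 {t}E.
rewrite -ge0_integralZl//; last 2 first.
- exact: mI.
- by move=> y _; rewrite mule_ge0 ?lee_fin.
apply: ge0_le_integral => //.
- by move=> y _; rewrite mule_ge0 ?lee_fin.
- exact: mI.
- by apply: emeasurable_funM => //; exact: mI.
move=> y _; rewrite muleCA lee_wpmul2l ?lee_fin//.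
rewrite -ge0_integralZl//; last 2 first.
- exact: (measurable_fun_pair2 y (mS k mk)).
- by move=> z _; exact: (S0 k (y, z)).
apply: ge0_le_integral => //.
- by move=> z _; exact: (S0 k2 (y, z)).
- exact: (measurable_fun_pair2 y (mS k2 mk2)).
- by apply: emeasurable_funM => //; exact: (measurable_fun_pair2 y (mS k mk)).
by move=> z _; rewrite muleCA lee_wpmul2l ?lee_fin//; exact: sqnorm_increment_half.
Qed.

End Halving.

(** * Bounds on the bias and the variance *)

Section LowerBounds.
Local Open Scope classical_set_scope.
Variable R : realType.
Local Notation leb := (@lebesgue_measure R).

(** The integrals over [-n, n] tend to 1 by dominated convergence, hence eventually exceed 1/2. *)
Lemma half_mass (g : R -> R) : leb.-integrable setT (EFin \o g) ->
  \int[leb]_x g x = 1 ->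
  exists2 L : R, 0 < L & 2^-1 <= \int[leb]_(x in `[- L, L]) g x.
Proof.
move=> ig g1.
have mg := integrableR_measurable ig.
pose u (n : nat) (x : R) := g x * \1_(`[- n%:R, n%:R]) x.
have cu : \int[leb]_x u n x @[n --> \oo] --> \int[leb]_x g x.
  apply: (@Rintegral_cvg R u g (fun x => `|g x|)).
  - move=> n; apply: measurable_funM => //; exact: measurable_indic.
  - move=> x; apply: cvg_near_cst; exists (Num.truncn `|x|).+1 => // n /= xn.
    rewrite /u indicE mem_set ?mulr1// /= in_itv/= -ler_norml.
    rewrite (le_trans (ltW (truncnS_gt _)))// ler_nat//.
  - exact: integrable_norm.
  - move=> n x; rewrite /u normrM ler_piMr// indicE.
    by case: (_ \in _); rewrite /= ?normr1 ?normr0.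
rewrite g1 in cu.
have : \forall n \near \oo, 2^-1 < \int[leb]_x u n x.
  by apply: (cvgr_gt _ cu); rewrite invf_lt1// ltr1n.
(* Taking the next rank guarantees an interval of positive length. *)
move=> [n _ /(_ n.+1 (leqnSn n))] un.
exists n.+1%:R => //; apply: ltW; rewrite (lt_le_trans un)// le_eqVlt.
apply/orP; left; apply/eqP; rewrite [RHS]Rintegral_mkcond.
apply: eq_Rintegral => x _; rewrite /u patchE indicE.
by case: ifPn => _; rewrite ?mulr1 ?mulr0.
Qed.

(* On an interval carrying half of the mass of g, use
    (w - g)^2 >= 2 t (g - w) - t^2 for a suitable constant t. *)
Lemma sqnorm_far (g : R -> R) : leb.-integrable setT (EFin \o g) ->
  \int[leb]_x g x = 1 ->
  exists e b : R, [/\ 0 < e, 0 < b & forall w : R -> R,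
    leb.-integrable setT (EFin \o w) ->
    (forall x, `|w x| <= e) -> (b%:E <= sqnorm (fun x => (w x - g x)%R))%E].
Proof.
move=> ig /(half_mass ig)[L L0 gL].
pose t := (8 * L)^-1.
have t0 : 0 < t by rewrite invr_gt0 mulr_gt0.
exists t, (t / 4); split => //; first by rewrite divr_gt0.
move=> w iw wt.
pose I : set R := `[- L, L]%classic.
have mI : measurable (I : set (measurableTypeR R)) by exact: measurable_itv.
have iIg : leb.-integrable I (EFin \o g).
  exact: (integrableS measurableT mI (@subsetT _ _) ig).
have iIw : leb.-integrable I (EFin \o w).
  exact: (integrableS measurableT mI (@subsetT _ _) iw).
have muI : leb I = (2 * L)%:E.
  rewrite lebesgue_measure_itv/= lte_fin gtrN// -EFinD; congr EFin; ring.
have iIc (c : R) : leb.-integrable I (EFin \o cst c).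
  apply: measurable_bounded_integrable => //.
  - by change (leb I < +oo)%E; rewrite muI ltry.
  - exact: bounded_cst.
pose c := - (2 * t * t + t ^+ 2).
have iZ : leb.-integrable I (EFin \o (fun x => 2 * t * g x)).
  exact: (integrableZl mI (2 * t) iIg).
apply: (@le_trans _ _ (\int[leb]_(x in I) (2 * t * g x + c)%:E)%E).
  have -> : (\int[leb]_(x in I) (2 * t * g x + c)%:E)%E =
      (\int[leb]_(x in I) (2 * t * g x + c))%:E.
    rewrite fineK//; apply: integrable_fin_num => //.
    exact: (integrableD mI iZ (iIc c)).
  rewrite lee_fin RintegralD//; last exact: iIc.
  have fI : fine (leb I) = 2 * L by rewrite muI.
  rewrite RintegralZl// Rintegral_cst// fI.
  have -> : c * (2 * L) = - (3 / 4 * t) by rewrite /c /t; field; rewrite gt_eqF.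
  have := ler_wpM2l (ltW t0) gL; rewrite -/I; move: (Rintegral _ _ _) => G.
  lra.
have iR : leb.-integrable I (EFin \o (fun x => 2 * t * g x + c)).
  exact: (integrableD mI iZ (iIc c)).
have mw := integrableR_measurable iw; have mg := integrableR_measurable ig.
have msq : measurable_fun setT (fun x => ((w x - g x) ^+ 2)%:E).
  by apply/measurable_EFinP; apply: measurable_funX; exact: measurable_funB.
apply: (@le_trans _ _ (\int[leb]_(x in I) ((w x - g x) ^+ 2)%:E)%E); last first.
  apply: ge0_subset_integral => //.
  by move=> x _; rewrite lee_fin sqr_ge0.
have msqI : measurable_fun I (fun x => ((w x - g x) ^+ 2)%:E) by exact: measurable_funTS.
have [fin|] := ltP (\int[leb]_(x in I) ((w x - g x) ^+ 2)%:E)%E +oo%E; last first.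
  by rewrite leye_eq => /eqP ->; rewrite leey.
apply: le_integral => //.
  apply/integrableP; split => //.
  by under eq_integral do rewrite gee0_abs ?lee_fin ?sqr_ge0//.
move=> x _; rewrite lee_fin /c.
have := wt x; rewrite ler_norml => /andP[_ wx].
have := sqr_ge0 (g x - w x - t).
nra.
Qed.

(** The case [w = 0] of [sqnorm_far]. *)
Lemma sqnorm_kernel_gt0 (g : R -> R) : leb.-integrable setT (EFin \o g) ->
  \int[leb]_x g x = 1 -> (0 < sqnorm g)%E.
Proof.
move=> ig /(sqnorm_far ig)[e [b [e0 b0 H]]].
have c0 (x : R) : `|cst (0 : R) x| <= e by rewrite /= normr0 ltW.
have {H} := H (cst 0) (integrable0 _ _) c0.
rewrite /sqnorm; under eq_integral do rewrite sub0r sqrrN.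
by apply: lt_le_trans; rewrite lte_fin.
Qed.

End LowerBounds.

(** * Scaling of the kernel by the bandwidth *)

Section Kernel.
Local Open Scope classical_set_scope.
Variable R : realType.
Local Notation leb := (@lebesgue_measure R).
Variables (K : R -> R) (M : R).
Hypothesis iK : leb.-integrable setT (EFin \o K).
Hypothesis KM : forall x, `|K x| <= M.

(** The trailing [+ 0] gives the argument the shape expected by the affine changes of variables. *)
Lemma KhE h x : Kh K h x = h^-1 * K (h^-1 * x + 0).
Proof. by rewrite /Kh addr0 mulrC (mulrC x). Qed.

Lemma Kh_integrable h : 0 < h -> leb.-integrable setT (EFin \o Kh K h).
Proof.
move=> h0; apply: integrableR_eq (fun x => esym (KhE h x)) _.
by apply: integrableRZl; apply: integrable_affine => //; rewrite invr_eq0 gt_eqF.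
Qed.

Lemma Kh_bound h x : 0 < h -> `|Kh K h x| <= M / h.
Proof. by move=> h0; rewrite /Kh normrM ler_pM// normfV gtr0_norm. Qed.

Lemma Rintegral_normKh h : 0 < h -> \int[leb]_x `|Kh K h x| = \int[leb]_x `|K x|.
Proof.
move=> h0; have hV : h^-1 != 0 by rewrite invr_eq0 gt_eqF.
have iaK := integrable_norm iK.
rewrite [RHS](Rintegral_affine 0 hV iaK) gtr0_norm ?invr_gt0// -RintegralZl//.
  apply: eq_Rintegral => x _.
  by rewrite KhE normrM gtr0_norm ?invr_gt0.
exact: (integrable_affine 0 hV iaK).
Qed.

Lemma sqnorm_Kh h : 0 < h -> (sqnorm (Kh K h) = h^-1%:E * sqnorm K)%E.
Proof.
move=> h0; have hV : h^-1 != 0 by rewrite invr_eq0 gt_eqF.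
have mK := integrableR_measurable iK.
have mK2 : measurable_fun setT (fun x => (K x ^+ 2)%:E).
  by apply/measurable_EFinP; exact: measurable_funX.
rewrite /sqnorm [in RHS](ge0_integral_affine 0 hV)//; last first.
  by move=> x; rewrite lee_fin sqr_ge0.
rewrite muleA -EFinM gtr0_norm ?invr_gt0// -ge0_integralZl//; last 3 first.
- exact: (measurableT_comp mK2 (measurable_affine h^-1 0)).
- by move=> x _; rewrite lee_fin sqr_ge0.
- by rewrite lee_fin mulr_ge0// invr_ge0 ltW.
by apply: eq_integral => x _; rewrite KhE exprMn -EFinM.
Qed.

End Kernel.

(** * Bias-variance decomposition and the lower bound of order 1/n *)

Section MISEBounds.
Local Open Scope classical_set_scope.
Variable R : realType.
Local Notation leb := (@lebesgue_measure R).
Variables (K f : R -> R).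
Hypothesis kK : is_kernel K.
Hypothesis L2K : L2 K.
Hypothesis df : prob_density f.
Hypothesis L2f : L2 f.

(** The integrated squared bias B(h); [variance] is W(h), not yet divided by the sample size. *)
Definition bias h := sqnorm (fun x => (conv (Kh K h) f x - f x)%R).
Definition variance h := totvar (Kh K h) f.

Lemma kernel_integrable : leb.-integrable setT (EFin \o K).
Proof. by case: kK. Qed.

Lemma kernel_Rintegral : \int[leb]_x K x = 1.
Proof. by case: kK => _ K1 _ _ _; rewrite /Rintegral K1. Qed.

Lemma kernel_bound : exists2 M : R, 0 <= M & forall x, `|K x| <= M.
Proof.
by case: kK => _ _ [M KM] _ _; exists M => //; rewrite (le_trans _ (KM 0)).
Qed.

Lemma bias_ge0 h : (0 <= bias h)%E. Proof. exact: sqnorm_ge0. Qed.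
Lemma variance_ge0 h : (0 <= variance h)%E. Proof. exact: totvar_ge0. Qed.

(** [iid_expect_sqnorm] with offset -f and scale a = 1/n, for which n a^2 = 1/n. *)
Lemma MISE_decomposition n h : (0 < n)%N -> 0 < h ->
  (MISE n f K h = bias h + n%:R^-1%:E * variance h)%E.
Proof.
move=> n0 h0; have [M _ KM] := kernel_bound.
have iKh := Kh_integrable kernel_integrable h0.
have KhM x := Kh_bound KM x h0.
have [mf _ _] := df.
have nE : n%:R != 0 :> R by rewrite pnatr_eq0 -lt0n.
have := @iid_expect_sqnorm _ _ _ _ iKh KhM df n (fun x => - f x) n%:R^-1 _.
move=> /(_ (measurable_funN mf)) H.
transitivity (iid_expect f n (fun X => sqnorm (fun x => (- f x + n%:R^-1 * \sum_(y <- X) Kh K h (x - y))%R))).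
  congr iid_expect; apply/funext => X; rewrite /sqnorm.
  by apply: eq_integral => x _; rewrite /kde addrC.
rewrite H; congr (sqnorm _ + _%:E * _)%E.
  by apply/funext => x; rewrite mulrA mulVf// mul1r addrC.
by rewrite expr2 mulrA mulfV// mul1r.
Qed.

Lemma bias_far : exists h1 b : R, [/\ 0 < h1, 0 < b &
  forall h, h1 <= h -> (b%:E <= bias h)%E].
Proof.
have [M M0 KM] := kernel_bound.
have if_ := density_integrable df.
have [e [b [e0 b0 H]]] := sqnorm_far if_ (density_Rintegral df).
(* The convolution is bounded by [M / h], hence by [e] beyond this threshold; [M + 1] keeps it
   positive when [M = 0]. *)
exists ((M + 1) / e), b; split => //; first by rewrite divr_gt0// ltr_wpDl.
move=> h hh; have h0 : 0 < h by rewrite (lt_le_trans _ hh)// divr_gt0// ltr_wpDl.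
have iKh := Kh_integrable kernel_integrable h0.
have KhM x := Kh_bound KM x h0.
apply: H; first exact: conv_integrable iKh if_ KhM.
have ic x : leb.-integrable setT (EFin \o (fun y => Kh K h (x - y) * f y)).
  apply: (integrable_bounded if_ _ (fun y => KhM (x - y))).
  by apply: measurable_rsub; exact: integrableR_measurable.
move=> x; rewrite (le_trans (le_normr_Rintegral _ (ic x)))//.
apply: (@le_trans _ _ (\int[leb]_y (M / h * f y))).
  apply: le_Rintegral => //; [exact: integrable_norm|exact: integrableRZl|].
  move=> y _; have [_ f0 _] := df.
  by rewrite normrM (ger0_norm (f0 y)) ler_wpM2r.
rewrite RintegralZl// density_Rintegral// mulr1 ler_pdivrMr//.
rewrite ler_pdivrMr// in hh; rewrite mulrC (le_trans _ hh)// lerDl//.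
Qed.

Lemma variance_near0 (A : R) : exists2 h0 : R, 0 < h0 &
  forall h, 0 < h -> h <= h0 -> (A%:E <= variance h)%E.
Proof.
have [M M0 KM] := kernel_bound; have iK := kernel_integrable.
pose kappa := \int[leb]_x `|K x|.
have kappa1 : 1 <= kappa.
  rewrite -kernel_Rintegral; apply: le_Rintegral => //; first exact: integrable_norm.
  by move=> x _; exact: ler_norm.
have kappa0 : 0 < kappa by rewrite (lt_le_trans _ kappa1).
have /fineK sKE : sqnorm K \is a fin_num by rewrite ge0_fin_numE ?sqnorm_ge0//; case: L2K.
have /fineK sfE : sqnorm f \is a fin_num by rewrite ge0_fin_numE ?sqnorm_ge0//; case: L2f.
have sK0 : 0 < fine (sqnorm K).
  by rewrite -lte_fin sKE; exact: sqnorm_kernel_gt0 iK kernel_Rintegral.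
have sf0 : 0 <= fine (sqnorm f) by rewrite fine_ge0// sqnorm_ge0.
pose Y := kappa ^+ 2 * fine (sqnorm f).
have Y0 : 0 <= Y by rewrite mulr_ge0// sqr_ge0.
have YA : 0 < Y + `|A| + 1 by rewrite ltr_wpDl// addr_ge0.
(* Up to this bandwidth ||K||^2 / h is at least Y + |A| + 1, of which ||mu_h||^2 takes away at most
   [Y] by Young's inequality; the 1 keeps the denominator positive. *)
exists (fine (sqnorm K) / (Y + `|A| + 1)); first by rewrite divr_gt0.
move=> h h0 hh; have iKh := Kh_integrable iK h0; have KhM x := Kh_bound KM x h0.
have E := totvarE iKh KhM df.
have := @sqnorm_conv_le _ _ _ _ iKh KhM df kappa.
rewrite (Rintegral_normKh iK h0) => /(_ (lexx _) kappa0).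
rewrite -sfE -EFinM -/Y => cY.
rewrite (sqnorm_Kh iK h0) -sKE -EFinM in E.
have fc : sqnorm (conv (Kh K h) f) \is a fin_num.
  by rewrite ge0_fin_numE ?sqnorm_ge0// (le_lt_trans cY)// ltry.
have -> : variance h = ((h^-1 * fine (sqnorm K))%:E - sqnorm (conv (Kh K h) f))%E.
  by rewrite -E addeK.
rewrite leeBrDr//; apply: (@le_trans _ _ (A%:E + Y%:E)%E); first exact: leeD2l.
rewrite -EFinD lee_fin; rewrite ler_pdivlMr// in hh.
rewrite mulrC ler_pdivlMr//; apply: le_trans hh; rewrite mulrC ler_wpM2l ?ltW//.
by have := ler_norm A; lra.
Qed.

(** [totvar_half] applies because K_(h/2)(x) = 2 K_h(2 x). *)
Lemma variance_half h : 0 < h -> (variance (h / 2) <= 8%:E * variance h)%E.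
Proof.
move=> h0; have [M M0 KM] := kernel_bound; have iK := kernel_integrable.
have h20 : 0 < h / 2 by rewrite divr_gt0.
apply: (@totvar_half _ _ _ _ (M / h)) => //.
- exact: Kh_integrable.
- by move=> x; exact: Kh_bound.
- exact: Kh_integrable.
- move=> x; rewrite (le_trans (Kh_bound KM x h20))// le_eqVlt; apply/orP; left; apply/eqP.
  by field; rewrite gt_eqF.
- move=> x; rewrite /Kh (_ : x / (h / 2) = 2 * x / h); last by field; rewrite gt_eqF.
  by field; rewrite gt_eqF.
Qed.

(* Halve h until it falls in the range where the variance is at least 1. *)
Lemma variance_bounded_away (h1 : R) : 0 < h1 -> exists2 w : R, 0 < w &
  forall h, 0 < h -> h <= h1 -> (w%:E <= variance h)%E.
Proof.
move=> h10; have [h0 h00 H0] := variance_near0 1.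
(* Each halving costs a factor 8. The number [j] of halvings chosen below depends only on [h1 / h0],
   so the bound is uniform in h <= h1. *)
have pow j : forall h, 0 < h -> h / 2 ^+ j <= h0 -> ((8^-1 ^+ j)%:E <= variance h)%E.
  elim: j => [|j IH] h hp hh.
    by rewrite expr0; apply: H0 => //; rewrite expr0 divr1 in hh.
  have := IH (h / 2); rewrite divr_gt0// => /(_ isT).
  rewrite -mulrA -invfM -exprS => /(_ hh) H.
  have := le_trans H (variance_half hp); move: (variance h) => v {}H.
  have : (8^-1%:E * (8^-1 ^+ j)%:E <= 8^-1%:E * (8%:E * v))%E.
    by apply: lee_wpmul2l H; rewrite lee_fin invr_ge0.
  by rewrite muleA -!EFinM -exprS mulVf ?pnatr_eq0// mul1e.
have [j Hj] : exists j : nat, h1 / h0 <= 2 ^+ j.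
  exists (Num.truncn (h1 / h0)).+1.
  apply: (le_trans (ltW (truncnS_gt _))).
  by rewrite -natrX ler_nat ltnW// ltn_expl.
exists (8^-1 ^+ j); first by rewrite exprn_gt0// invr_gt0.
move=> h hp hh; apply: pow => //; rewrite ler_pdivrMr ?exprn_gt0//.
rewrite (le_trans hh)// mulrC -ler_pdivrMr//.
Qed.

(** Beyond [h1] the bias alone is at least b >= b / n; up to [h1] the variance term is at least w /
    n. *)
Lemma MISE_lower_bound : exists2 c : R, 0 < c &
  forall (n : nat) h, (0 < n)%N -> 0 < h -> ((c / n%:R)%:E <= MISE n f K h)%E.
Proof.
have [h1 [b [h10 b0 Hb]]] := bias_far.
have [w w0 Hw] := variance_bounded_away h10.
exists (Num.min b w); first by rewrite lt_min b0.
move=> n h n0 h0; rewrite MISE_decomposition//.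
have np : 0 < n%:R :> R by rewrite ltr0n.
have [hh|hh] := leP h1 h.
  apply: (@le_trans _ _ (bias h)); last first.
    by rewrite leeDl// mule_ge0 ?variance_ge0// lee_fin invr_ge0 ltW.
  apply: le_trans (Hb _ hh); rewrite lee_fin ler_pdivrMr//.
  rewrite (@le_trans _ _ b)// ?ge_min ?lexx// ler_peMr ?(ltW b0)//.
  by rewrite ler1n.
apply: (@le_trans _ _ (n%:R^-1%:E * variance h)%E); last by rewrite leeDr// bias_ge0.
apply: (@le_trans _ _ (n%:R^-1%:E * w%:E)%E); last first.
  by apply: lee_wpmul2l; [rewrite lee_fin invr_ge0 ltW|apply: Hw => //; exact: ltW].
by rewrite -EFinM lee_fin mulrC ler_wpM2l ?invr_ge0 ?(ltW np)// ge_min lexx orbT.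
Qed.

End MISEBounds.

(** * Uniqueness of Fourier transforms *)

Section Uniqueness.
Local Open Scope classical_set_scope.
Variable R : realType.
Local Notation leb := (@lebesgue_measure R).

Lemma is_derive_continuous (f : R -> R) (x df : R) :
  is_derive x 1 f df -> {for x, continuous f}.
Proof.
by move=> dF; apply: differentiable_continuous; apply/derivable1_diffP.
Qed.

Lemma Rintegral_FTC (f F : R -> R) (a b : R) : a <= b -> continuous f ->
  (forall x : R, is_derive x 1 F (f x)) ->
  \int[leb]_(x in `[a, b]) f x = F b - F a.
Proof.
rewrite le_eqVlt => /predU1P[<- _ _|ab cf dF].
  by rewrite set_itv1 Rintegral_set1 subrr.
have cF : continuous F.
  by move=> x; exact: is_derive_continuous (dF x).
rewrite /Rintegral (@continuous_FTC2 R f F)//.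
- by apply: continuous_subspaceT.
- split.
  + by move=> x _; apply: ex_derive.
  + exact: cvg_at_right_filter (cF a).
  + exact: cvg_at_left_filter (cF b).
- by move=> x _; rewrite derive1E; apply: derive_val.
Qed.

Lemma continuous_integrable_itv (f : R -> R) (a b : R) : continuous f ->
  leb.-integrable setT (EFin \o (fun x => \1_(`[a, b]) x * f x)).
Proof.
move=> cf.
have mI : measurable (`[a, b]%classic : set (measurableTypeR R)) by exact: measurable_itv.
have iI : leb.-integrable `[a, b] (EFin \o f).
  by apply: continuous_compact_integrable; [exact: segment_compact|exact: continuous_subspaceT].
have := (@integrable_mkcond _ (measurableTypeR R) R leb _ (EFin \o f) mI).1 iI.
apply: eq_integrable => // x _.
by rewrite /= patchE indicE; case: ifPn => xab /=; rewrite ?mul1r ?mul0r.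
Qed.

Lemma Rintegral_indic_itv (f : R -> R) (a b : R) :
  \int[leb]_x (\1_(`[a, b]) x * f x) = \int[leb]_(x in `[a, b]) f x.
Proof.
rewrite [RHS]Rintegral_mkcond; apply: eq_Rintegral => x _.
by rewrite patchE indicE; case: ifPn => _; rewrite ?mul1r ?mul0r.
Qed.

(** Mainly for superposing test functions: if every phi (t, .) integrates to 0 against [g], so does
    their average in [t] with weight [w]. *)
Lemma Rintegral_fubini_prod (w g : R -> R) (phi : R * R -> R) (C : R) :
  leb.-integrable setT (EFin \o w) -> leb.-integrable setT (EFin \o g) ->
  measurable_fun setT phi -> (forall z, `|phi z| <= C) ->
  leb.-integrable setT (EFin \o (fun t => w t * \int[leb]_y (phi (t, y) * g y))) /\
  \int[leb]_t (w t * \int[leb]_y (phi (t, y) * g y)) =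
  \int[leb]_y ((\int[leb]_t (w t * phi (t, y))) * g y).
Proof.
move=> iw ig mphi phiC.
have mw := integrableR_measurable iw; have mg := integrableR_measurable ig.
have ipg t : leb.-integrable setT (EFin \o (fun y => phi (t, y) * g y)).
  apply: (integrable_bounded ig _ (fun y => phiC (t, y))).
  exact: (measurable_fun_pair2 t mphi).
have iwp y : leb.-integrable setT (EFin \o (fun t => w t * phi (t, y))).
  apply: integrableR_eq (fun t => mulrC _ _) _.
  apply: (integrable_bounded iw _ (fun t => phiC (t, y))).
  exact: (measurable_fun_pair1 y mphi).
pose G (z : R * R) := w z.1 * (phi z * g z.2).
have iGy y : leb.-integrable setT (EFin \o (fun t => G (t, y))).
  by apply: integrableR_eq (integrableRZr (g y) (iwp y)) => t; rewrite /G/= mulrA.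
have := @Rintegral_fubini R G (fun y => (C * \int[leb]_t `|w t|) * `|g y|).
case.
- apply: measurable_funM; first exact: (measurableT_comp mw measurable_fst).
  by apply: measurable_funM => //; exact: (measurableT_comp mg measurable_snd).
- by move=> t; exact: (integrableRZl (w t) (ipg t)).
- exact: iGy.
- exact: integrableRZl (integrable_norm ig).
- move=> y; rewrite mulrAC -RintegralZl//; last exact: integrable_norm.
  apply: le_Rintegral => //.
  + exact: integrable_norm (iGy y).
  + by apply: integrableRZl; exact: integrable_norm.
  + move=> t _; rewrite !normrM mulrC ler_wpM2r// ler_wpM2r//.
rewrite /G/= => iGt E.
have wE t : \int[leb]_y (w t * (phi (t, y) * g y)) = w t * \int[leb]_y (phi (t, y) * g y).
  by rewrite RintegralZl.
split; first exact: integrableR_eq iGt.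
transitivity (\int[leb]_t \int[leb]_y (w t * (phi (t, y) * g y))).
  by apply: eq_Rintegral => t _; rewrite wE.
rewrite E; apply: eq_Rintegral => y _; rewrite -RintegralZr//.
by apply: eq_Rintegral => t _; rewrite mulrA.
Qed.

Lemma is_deriveRD (f g : R -> R) (x df dg : R) :
  is_derive x 1 f df -> is_derive x 1 g dg -> is_derive x 1 (fun t => f t + g t) (df + dg).
Proof. exact: is_deriveD. Qed.

Lemma is_deriveRM (f g : R -> R) (x df dg : R) :
  is_derive x 1 f df -> is_derive x 1 g dg ->
  is_derive x 1 (fun t => f t * g t) (f x * dg + g x * df).
Proof. exact: is_deriveM. Qed.

Lemma is_deriveRZ (f : R -> R) (c x df : R) :
  is_derive x 1 f df -> is_derive x 1 (fun t => c * f t) (c * df).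
Proof. exact: is_deriveZ. Qed.

Lemma is_derive_comp_affine (f : R -> R) (c d t df : R) :
  is_derive (c * t + d) 1 f df -> is_derive t 1 (fun t => f (c * t + d)) (c * df).
Proof.
move=> dF.
have dl : is_derive t 1 (fun t : R => c * t + d) c.
  rewrite -[X in is_derive _ _ _ X]addr0 -[X in X + _]mulr1.
  by apply: is_deriveRD; apply: is_deriveRZ.
rewrite mulrC; exact: (@is_derive1_comp _ f (fun t : R => c * t + d)).
Qed.

(** The Poisson kernel of the half-plane without its factor 1 / pi; as a function of [a], the
    Laplace transform of t |-> cos (t z). *)
Definition poisson_kernel (a z : R) : R := a / (a ^+ 2 + z ^+ 2).

Let den_gt0 (a z : R) : 0 < a -> 0 < a ^+ 2 + z ^+ 2.
Proof. by move=> a0; rewrite ltr_pwDl ?sqr_ge0// exprn_gt0. Qed.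

(** An explicit antiderivative [F] is evaluated at both ends: 0 contributes the Poisson kernel, [T]
    a remainder that decays exponentially. *)
Lemma integral_exp_cos (a z T : R) : 0 < a -> 0 <= T ->
  \int[leb]_(t in `[0, T]) (expR (- a * t) * cos (t * z)) =
  poisson_kernel a z + expR (- a * T) * (z * sin (T * z) - a * cos (T * z)) / (a ^+ 2 + z ^+ 2).
Proof.
move=> a0 T0; have d0 := den_gt0 z a0.
pose F t : R := expR (- a * t) * (z * sin (t * z) - a * cos (t * z)) / (a ^+ 2 + z ^+ 2).
have dE (t : R) : is_derive t 1 (fun t : R => expR (- a * t)) (- a * expR (- a * t)).
  have := @is_derive_comp_affine expR (- a) 0 t _ (is_derive_expR _).
  by under eq_fun do rewrite addr0; rewrite addr0.
have dS (t : R) : is_derive t 1 (fun t : R => sin (t * z)) (z * cos (t * z)).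
  have := @is_derive_comp_affine sin z 0 t _ (is_derive_sin _).
  by under eq_fun do rewrite addr0 mulrC; rewrite addr0 mulrC (mulrC z t) mulrC.
have dC (t : R) : is_derive t 1 (fun t : R => cos (t * z)) (z * (- sin (t * z))).
  have := @is_derive_comp_affine cos z 0 t _ (is_derive_cos _).
  by under eq_fun do rewrite addr0 mulrC; rewrite addr0 (mulrC z t).
have dF (t : R) : is_derive t 1 F (expR (- a * t) * cos (t * z)).
  have := is_deriveRZ (a ^+ 2 + z ^+ 2)^-1 (is_deriveRM (dE t)
    (is_deriveRD (is_deriveRZ z (dS t)) (is_deriveRZ (- a) (dC t)))).
  rewrite (_ : (fun _ => _) = F); last first.
    by apply/funext => s; rewrite /F [LHS]mulrC (mulNr a (cos _)).
  by move=> /is_derive_eq; apply; field; rewrite gt_eqF.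
have cf : continuous (fun t : R => expR (- a * t) * cos (t * z)).
  by move=> t; apply: cvgM;
    [exact: is_derive_continuous (dE t)|exact: is_derive_continuous (dC t)].
rewrite (Rintegral_FTC T0 cf dF).
rewrite /F mulr0 expR0 !mul0r sin0 cos0 mulr0 mulr1 sub0r mul1r addrC.
by rewrite mulNr opprK /poisson_kernel.
Qed.

(** * Integrable functions whose Fourier transform vanishes *)

Section Vanishing.
Variable g : R -> R.
Hypothesis ig : leb.-integrable setT (EFin \o g).
Hypothesis cos0 : forall t, \int[leb]_x (cos (t * x) * g x) = 0.
Hypothesis sin0 : forall t, \int[leb]_x (sin (t * x) * g x) = 0.

Let mg := integrableR_measurable ig.

Lemma measurable_cos_mul (t : R) : measurable_fun setT (fun x : R => cos (t * x)).
Proof.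
apply: (measurableT_comp (continuous_measurable_fun (@continuous_cos R))).
exact: measurable_funM.
Qed.

Lemma measurable_sin_mul (t : R) : measurable_fun setT (fun x : R => sin (t * x)).
Proof.
apply: (measurableT_comp (continuous_measurable_fun (@continuous_sin R))).
exact: measurable_funM.
Qed.

Let icos t : leb.-integrable setT (EFin \o (fun x => cos (t * x) * g x)).
Proof. by apply: (integrable_bounded ig (measurable_cos_mul t)) => x; exact: cos_max. Qed.

Let isin t : leb.-integrable setT (EFin \o (fun x => sin (t * x) * g x)).
Proof. by apply: (integrable_bounded ig (measurable_sin_mul t)) => x; exact: sin_max. Qed.

Lemma translate_cos0 (t x : R) : \int[leb]_y (cos (t * (x - y)) * g y) = 0.
Proof.
transitivity (\int[leb]_y (cos (t * x) * (cos (t * y) * g y) + sin (t * x) * (sin (t * y) * g y))).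
  by apply: eq_Rintegral => y _; rewrite mulrBr cosB; ring.
by rewrite RintegralD ?RintegralZl ?cos0 ?sin0 ?mulr0 ?addr0//; exact: integrableRZl.
Qed.

(* The truncated Poisson kernel is a superposition over t in [0, T] of the
    functions cos (t (x - y)), against which g integrates to 0. *)
Lemma truncated_poisson0 (a x T : R) : 0 < a -> 0 <= T ->
  \int[leb]_y ((poisson_kernel a (x - y) + expR (- a * T) *
    ((x - y) * sin (T * (x - y)) - a * cos (T * (x - y))) / (a ^+ 2 + (x - y) ^+ 2)) * g y) = 0.
Proof.
move=> a0 T0.
have ce : continuous (fun t : R => expR (- a * t)).
  by move=> t; apply: (@continuous_comp _ _ _ (fun t : R => - a * t) expR);
    [exact: mulrl_continuous|exact: continuous_expR].
pose w t : R := \1_(`[0, T]) t * expR (- a * t).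
have iw : leb.-integrable setT (EFin \o w) by exact: continuous_integrable_itv.
pose phi (z : R * R) : R := cos (z.1 * (x - z.2)).
have mphi : measurable_fun setT phi.
  apply: (measurableT_comp (continuous_measurable_fun (@continuous_cos R))).
  apply: measurable_funM; first exact: measurable_fst.
  by apply: measurable_funB => //; exact: measurable_snd.
have phi1 z : `|phi z| <= 1 by exact: cos_max.
have [_ +] := Rintegral_fubini_prod iw ig mphi phi1.
rewrite (_ : \int[leb]_t _ = 0); last first.
  rewrite /phi/=; under eq_Rintegral do rewrite translate_cos0 mulr0.
  by rewrite /Rintegral integral0.
move=> /esym E; rewrite -[RHS]E; apply: eq_Rintegral => y _; congr (_ * _).
rewrite -(integral_exp_cos _ a0 T0) -Rintegral_indic_itv.
by apply: eq_Rintegral => t _; rewrite /w /phi/= mulrA.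
Qed.

(** Bounds the remainder of [integral_exp_cos], apart from its exponential factor, by [2 / a]
    uniformly in [T] and [z]. *)
Let le_sum_den (a z : R) : 0 < a -> a * (a + `|z|) <= 2 * (a ^+ 2 + z ^+ 2).
Proof.
move=> a0; rewrite -[z ^+ 2]real_normK ?num_real//.
have := sqr_ge0 (a - `|z|); have := sqr_ge0 a; have := sqr_ge0 `|z|; nra.
Qed.

Lemma poisson_bound (a z : R) : 0 < a -> `|poisson_kernel a z| <= a^-1.
Proof.
move=> a0; have d0 := den_gt0 z a0.
have p0 : 0 <= poisson_kernel a z by apply: divr_ge0; exact: ltW.
rewrite (ger0_norm p0) /poisson_kernel ler_pdivrMr// mulrDr expr2 mulKf ?gt_eqF//.
by rewrite lerDl mulr_ge0 ?sqr_ge0// invr_ge0 ltW.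
Qed.

(** Let T = n tend to infinity in [truncated_poisson0]; the truncated kernels are bounded by 1/a +
    2/a, so dominated convergence applies. *)
Lemma poisson0 (a x : R) : 0 < a -> \int[leb]_y (poisson_kernel a (x - y) * g y) = 0.
Proof.
move=> a0.
pose P (n : nat) (z : R) := poisson_kernel a z + expR (- a * n%:R) *
    (z * sin (n%:R * z) - a * cos (n%:R * z)) / (a ^+ 2 + z ^+ 2).
have rb (T z : R) : `|(z * sin (T * z) - a * cos (T * z)) / (a ^+ 2 + z ^+ 2)| <= 2 / a.
  have d0 := den_gt0 z a0.
  rewrite normrM normfV (gtr0_norm d0) ler_pdivrMr// mulrAC ler_pdivlMr// mulrC.
  apply: le_trans (le_sum_den z a0); rewrite ler_wpM2l ?(ltW a0)//.
  rewrite (le_trans (ler_normB _ _))// addrC !normrM (gtr0_norm a0).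
  by rewrite lerD// ler_piMr ?(ltW a0)// ?cos_max ?sin_max.
have e1 (n : nat) : expR (- a * n%:R) <= 1.
  by rewrite -[leRHS]expR0 ler_expR mulNr oppr_le0 mulr_ge0 ?(ltW a0).
have Pc z : P n z @[n --> \oo] --> poisson_kernel a z.
  rewrite -[X in _ --> X]addr0; apply: cvgD; first exact: cvg_cst.
  have e0 : expR (- a * n%:R) * (2 / a) @[n --> \oo] --> (0 : R).
    rewrite -(mul0r (2 / a)); apply: cvgMl.
    rewrite (_ : (fun n => _) = (fun n => (expR (- a)) ^+ n)); last first.
      by apply/funext => n; rewrite -expRM_natr.
    apply: cvg_expr; rewrite ger0_norm ?expR_ge0// expR_lt1// oppr_lt0//.
  apply: norm_cvg0; apply: (squeeze_cvgr _ (cvg_cst 0) e0).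
  apply: nearW => n; rewrite normr_ge0/= -mulrA normrM ger0_norm ?expR_ge0//.
  by rewrite ler_wpM2l ?expR_ge0.
have mP n : measurable_fun setT (P n).
  apply: continuous_measurable_fun => z.
  have cd : {for z, continuous (fun z : R => (a ^+ 2 + z ^+ 2)^-1)}.
    apply: cvgV; first by rewrite gt_eqF// den_gt0.
    by apply: cvgD; [exact: cvg_cst|exact: exprn_continuous].
  apply: cvgD; first by apply: cvgM => //; exact: cvg_cst.
  apply: cvgM => //; apply: cvgM; first exact: cvg_cst.
  apply: cvgB; apply: cvgM; try exact: cvg_cst; try exact: cvg_id.
    by apply: (@continuous_comp _ _ _ (fun z : R => n%:R * z) sin);
      [exact: mulrl_continuous|exact: continuous_sin].
  by apply: (@continuous_comp _ _ _ (fun z : R => n%:R * z) cos);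
      [exact: mulrl_continuous|exact: continuous_cos].
have H : \int[leb]_y (P n (x - y) * g y) @[n --> \oo] --> \int[leb]_y (poisson_kernel a (x - y) * g y).
  apply: (@Rintegral_cvg R (fun n y => P n (x - y) * g y) _ (fun y => (a^-1 + 2 / a) * `|g y|)).
  - by move=> n; apply: measurable_funM => //; exact: measurable_rsub.
  - by move=> y; apply: cvgMl; exact: Pc.
  - by apply: integrableRZl; exact: integrable_norm ig.
  - move=> n y; rewrite normrM ler_wpM2r// (le_trans (ler_normD _ _))// lerD ?poisson_bound//.
    rewrite -mulrA normrM ger0_norm ?expR_ge0// (le_trans _ (rb n%:R (x - y)))//.
    by rewrite ler_piMl// e1.
have H0 : \int[leb]_y (P n (x - y) * g y) @[n --> \oo] --> (0 : R).
  rewrite (_ : (fun n => _) = cst 0); first exact: cvg_cst.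
  by apply/funext => m; rewrite /P truncated_poisson0.
by rewrite -(cvg_lim (@Rhausdorff R) H) (cvg_lim (@Rhausdorff R) H0).
Qed.

Lemma integral_poisson (a b c y : R) : 0 < a -> c <= b ->
  \int[leb]_(x in `[c, b]) poisson_kernel a (x - y) =
  atan ((b - y) / a) - atan ((c - y) / a).
Proof.
move=> a0 cb.
have cpois : continuous (fun x => poisson_kernel a (x - y)).
  move=> z; apply: cvgM; first exact: cvg_cst.
  apply: cvgV; first by rewrite gt_eqF// den_gt0.
  apply: cvgD; first exact: cvg_cst.
  by apply: cvgM; apply: cvgB; [exact: cvg_id|exact: cvg_cst|exact: cvg_id|exact: cvg_cst].
have dat (x : R) : is_derive x 1 (fun x : R => atan ((x - y) / a)) (poisson_kernel a (x - y)).
  have := @is_derive_comp_affine atan a^-1 (- (y / a)) x _ (is_derive1_atan _).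
  have E z : a^-1 * z + - (y / a) = (z - y) / a by ring.
  under eq_fun do rewrite E; rewrite E => /is_derive_eq; apply.
  by rewrite /poisson_kernel; field; rewrite !gt_eqF ?den_gt0// ltr_pwDl ?sqr_ge0// exprn_gt0.
exact: (Rintegral_FTC cb cpois dat).
Qed.

(* The arctangent difference is the Poisson kernel integrated over [c, b]; as
    a -> 0 it tends to pi times the indicator of [c, b]. *)
Lemma atan_diff0 (a b c : R) : 0 < a -> c <= b ->
  \int[leb]_y ((atan ((b - y) / a) - atan ((c - y) / a)) * g y) = 0.
Proof.
move=> a0 cb.
have iw : leb.-integrable setT (EFin \o (fun x : R => \1_(`[c, b]) x * cst 1 x)).
  by apply: continuous_integrable_itv => z; exact: cvg_cst.
pose phi (z : R * R) := poisson_kernel a (z.1 - z.2).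
have cpois : continuous (poisson_kernel a).
  move=> z; apply: cvgM; first exact: cvg_cst.
  apply: cvgV; first by rewrite gt_eqF// den_gt0.
  by apply: cvgD; [exact: cvg_cst|exact: exprn_continuous].
have mphi : measurable_fun setT phi.
  by apply: measurable_subr; exact: continuous_measurable_fun.
have phiC z : `|phi z| <= a^-1 by exact: poisson_bound.
have [_ +] := Rintegral_fubini_prod iw ig mphi phiC.
rewrite (_ : \int[leb]_t _ = 0); last first.
  rewrite /phi/=; under eq_Rintegral do rewrite poisson0// mulr0.
  by rewrite /Rintegral integral0.
move=> /esym E; rewrite -[RHS]E; apply: eq_Rintegral => y _; congr (_ * _).
rewrite -(integral_poisson y a0 cb) -Rintegral_indic_itv.
by apply: eq_Rintegral => t _; rewrite /phi/= mulr1.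
Qed.

Lemma ae_neq (c : R) : {ae leb, forall x, x != c}.
Proof.
exists [set c]; split => //; first exact: lebesgue_measure_set1.
by move=> x /= /negP; rewrite negbK => /eqP.
Qed.

(** Oddness reduces to |z|; the sign function also covers [z = 0]. *)
Lemma cvg_atan_scale (z : R) : atan (z * n.+1%:R) @[n --> \oo] --> Num.sg z * (pi / 2).
Proof.
have cy : atan (n.+1%:R * `|z|) @[n --> \oo] --> Num.sg `|z| * (pi / 2 : R).
  have [->|z0] := eqVneq z 0.
    rewrite normr0 sgr0 mul0r; under eq_fun do rewrite mulr0 atan0.
    exact: cvg_cst.
  rewrite gtr0_sg ?normr_gt0// mul1r.
  apply: cvg_comp (@cvgy_atan R).
  apply/cvgryPge => A; near=> n.
  rewrite -ler_pdivrMr ?normr_gt0// (le_trans (ltW (truncnS_gt _)))// ler_nat ltnS.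
  by near: n; exists (Num.truncn (A / `|z|)).
have [z0|z0|->] := ltgtP z 0.
- rewrite ltr0_norm// gtr0_sg ?oppr_gt0// mul1r in cy.
  rewrite ltr0_sg// mulN1r -[X in X @ _](_ : (fun n => - atan (n.+1%:R * - z)) = _).
    exact: cvgN.
  by apply/funext => n; rewrite mulrN atanN opprK mulrC.
- by rewrite gtr0_norm// in cy; under eq_fun do rewrite mulrC.
- under eq_fun do rewrite mul0r atan0; rewrite sgr0 mul0r; exact: cvg_cst.
Unshelve. all: by end_near. Qed.

Lemma Rintegral_itv0 (c b : R) : c <= b -> \int[leb]_(x in `[c, b]) g x = 0.
Proof.
move=> cb.
pose u (n : nat) (y : R) := (atan ((b - y) / n.+1%:R^-1) - atan ((c - y) / n.+1%:R^-1)) * g y.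
have H : \int[leb]_y u n y @[n --> \oo] --> \int[leb]_y (pi * (\1_(`[c, b]) y * g y)).
  have matan (d r : R) : measurable_fun setT (fun y : R => atan ((d - y) / r)).
    apply: (measurableT_comp (continuous_measurable_fun (@continuous_atan R))).
    by apply: measurable_funM => //; exact: measurable_funB.
  apply: (@Rintegral_cvg_ae R u _ (fun y => pi * `|g y|)).
  - by move=> n; apply: measurable_funM => //; exact: measurable_funB.
  - by apply: measurable_funM => //; apply: measurable_funM => //; exact: measurable_indic.
  - have := ae_neq b; have := ae_neq c.
    apply: filterS2; first exact: (ae_filter_ringOfSetsType leb).
    move=> y yc yb; rewrite mulrA; apply: cvgMl.
    (* This identity fails at the endpoints of a nondegenerate interval; the points [b] and [c] are
       excluded as a null set. *)
    rewrite (_ : pi * \1_(`[c, b]) y = Num.sg (b - y) * (pi / 2) - Num.sg (c - y) * (pi / 2)).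
      by apply: cvgB; under eq_fun do rewrite invrK; exact: cvg_atan_scale.
    rewrite indicE; case: (ltgtP y b) yb => // yb _; case: (ltgtP c y) yc => // cy _.
    + rewrite mem_set /= ?in_itv/= ?(ltW yb) ?(ltW cy)//.
      by rewrite gtr0_sg ?subr_gt0// ltr0_sg ?subr_lt0//; field.
    + rewrite memNset /= ?in_itv/= ?leNgt ?cy//.
      by rewrite !gtr0_sg ?subr_gt0//; field.
    + rewrite memNset /= ?in_itv/= ?[y <= b]leNgt ?yb ?andbF//.
      by rewrite !ltr0_sg ?subr_lt0//; field.
    + by have := lt_le_trans (lt_trans yb cy) cb; rewrite ?ltxx.
  - by apply: integrableRZl; exact: integrable_norm ig.
  - move=> n y; rewrite normrM ler_wpM2r// (le_trans (ler_normB _ _))//.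
    have ab z : `|atan z| <= pi / 2 :> R.
      by rewrite ler_norml ltW ?atan_gtNpi2//= ltW// atan_ltpi2.
    by rewrite (le_trans (lerD (ab _) (ab _)))// -splitr.
have H0 : \int[leb]_y u n y @[n --> \oo] --> (0 : R).
  rewrite (_ : (fun n => _) = cst 0); first exact: cvg_cst.
  by apply/funext => m; rewrite /u atan_diff0.
have : \int[leb]_y (pi * (\1_(`[c, b]) y * g y)) = 0.
  by rewrite -(cvg_lim (@Rhausdorff R) H) (cvg_lim (@Rhausdorff R) H0).
rewrite RintegralZl//; last first.
  apply: (integrable_bounded ig (measurable_indic _) (M := 1)) => //.
  by move=> x; rewrite indicE; case: (_ \in _); rewrite /= ?normr1 ?normr0.
rewrite Rintegral_indic_itv => /eqP.
by rewrite mulf_eq0 gt_eqF ?pi_gt0//= => /eqP.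
Qed.

Lemma fourier_unique : {ae leb, forall x, g x = 0}.
Proof. by apply: ae0_of_integral_itv0 => // a b; exact: Rintegral_itv0. Qed.

End Vanishing.

End Uniqueness.

(** * Characteristic functions *)

Section CharFun.
Local Open Scope classical_set_scope.
Variable R : realType.
Local Notation leb := (@lebesgue_measure R).

Definition cosT (g : R -> R) (t : R) : R := \int[leb]_x (cos (t * x) * g x).
Definition sinT (g : R -> R) (t : R) : R := \int[leb]_x (sin (t * x) * g x).

Lemma charfunE g t : charfun g t = (cosT g t +i* sinT g t)%C.
Proof. by []. Qed.

Lemma charfun_neq1 (g : R -> R) (t : R) : (`|charfun g t - 1| != 0) = (charfun g t != 1).
Proof. by rewrite normr_eq0 subr_eq0. Qed.

Lemma cosTN g t : cosT g (- t) = cosT g t.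
Proof. by apply: eq_Rintegral => x _; rewrite mulNr cosN. Qed.

Section Integrable.
Variable g : R -> R.
Hypothesis ig : leb.-integrable setT (EFin \o g).

Lemma integrable_cosM t : leb.-integrable setT (EFin \o (fun x => cos (t * x) * g x)).
Proof. by apply: (integrable_bounded ig (measurable_cos_mul t)) => x; exact: cos_max. Qed.

Lemma integrable_sinM t : leb.-integrable setT (EFin \o (fun x => sin (t * x) * g x)).
Proof. by apply: (integrable_bounded ig (measurable_sin_mul t)) => x; exact: sin_max. Qed.

Lemma sinTN t : sinT g (- t) = - sinT g t.
Proof.
rewrite -[RHS]mulN1r /sinT -RintegralZl//; last exact: integrable_sinM.
by apply: eq_Rintegral => x _; rewrite mulNr sinN mulN1r mulNr.
Qed.

Lemma continuous_cosT : continuous (cosT g).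
Proof.
move=> t.
have := @continuity_under_integral R _ (measurableTypeR R) leb
  (fun t x => cos (t * x) * g x) setT measurableT (t - 1) (t + 1)
  (fun t _ => integrable_cosM t) _ (fun x => `|g x|) (integrable_norm ig) _.
apply.
- apply: aeW => x _ s _; apply: cvgM; last exact: cvg_cst.
  apply: (@continuous_comp _ _ _ (fun s : R => s * x) cos); last exact: continuous_cos.
  exact: mulrr_continuous.
- move=> s _; apply: aeW => x _.
  by rewrite normrM ler_piMl// cos_max.
- by rewrite inE/= in_itv/= ltrBlDr ltrDl ltr01.
Qed.

Lemma continuous_sinT : continuous (sinT g).
Proof.
move=> t.
have := @continuity_under_integral R _ (measurableTypeR R) leb
  (fun t x => sin (t * x) * g x) setT measurableT (t - 1) (t + 1)
  (fun t _ => integrable_sinM t) _ (fun x => `|g x|) (integrable_norm ig) _.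
apply.
- apply: aeW => x _ s _; apply: cvgM; last exact: cvg_cst.
  apply: (@continuous_comp _ _ _ (fun s : R => s * x) sin); last exact: continuous_sin.
  exact: mulrr_continuous.
- move=> s _; apply: aeW => x _.
  by rewrite normrM ler_piMl// sin_max.
- by rewrite inE/= in_itv/= ltrBlDr ltrDl ltr01.
Qed.

(** The real or the imaginary part is nonzero at [t], and stays so nearby by continuity. *)
Lemma charfun_near_neq0 t : charfun g t != 0 ->
  exists2 d : R, 0 < d & forall s, `|t - s| < d -> charfun g s != 0.
Proof.
have key (u : R -> R) : continuous u -> u t != 0 ->
    exists2 d : R, 0 < d & forall s, `|t - s| < d -> u s != 0.
  move=> cu ut.
  have /nbhs_ballP[d d0 Hd] : \forall s \near t, u s != 0.
    have : u s @[s --> t] --> u t by exact: cu.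
    by move=> /cvgr_neq0; apply.
  by exists d => // s ts; exact: Hd.
rewrite charfunE eq_complex negb_and /= => /orP[ct|st].
- have [d d0 H] := key _ continuous_cosT ct; exists d => // s /H cs.
  by rewrite charfunE eq_complex negb_and /= cs.
- have [d d0 H] := key _ continuous_sinT st; exists d => // s /H ss.
  by rewrite charfunE eq_complex negb_and /= ss orbT.
Qed.

End Integrable.

(** Fubini against cos and sin, then the addition formulas, produce the real and imaginary parts of
    the complex product. *)
Lemma charfun_conv (k f : R -> R) (M t : R) :
  leb.-integrable setT (EFin \o k) -> leb.-integrable setT (EFin \o f) ->
  (forall x, `|k x| <= M) ->
  charfun (conv k f) t = charfun k t * charfun f t.
Proof.
move=> ik if_ kM.
have shiftc y : \int[leb]_x (cos (t * x) * k (x - y)) =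
    cosT k t * cos (t * y) - sinT k t * sin (t * y).
  have ic := integrable_cosM ik t; have is_ := integrable_sinM ik t.
  have E u : cos (t * (u + y)) * k u =
      cos (t * y) * (cos (t * u) * k u) - sin (t * y) * (sin (t * u) * k u).
    by rewrite mulrDr cosD; ring.
  rewrite (_ : (\int[leb]_x _)%R = \int[leb]_u (cos (t * (u + y)) * k u)).
    under eq_Rintegral do rewrite E.
    rewrite RintegralB//; [|exact: integrableRZl|exact: integrableRZl].
    by rewrite !RintegralZl// -/(cosT k t) -/(sinT k t); ring.
  rewrite -[RHS](Rintegral_shift y).
    by apply: eq_Rintegral => x _; rewrite subrK.
  apply: integrableR_eq (fun u => esym (E u)) _.
  by apply: integrableRB; exact: integrableRZl.
have shifts y : \int[leb]_x (sin (t * x) * k (x - y)) =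
    sinT k t * cos (t * y) + cosT k t * sin (t * y).
  have ic := integrable_cosM ik t; have is_ := integrable_sinM ik t.
  have E u : sin (t * (u + y)) * k u =
      cos (t * y) * (sin (t * u) * k u) + sin (t * y) * (cos (t * u) * k u).
    by rewrite mulrDr sinD; ring.
  rewrite (_ : (\int[leb]_x _)%R = \int[leb]_u (sin (t * (u + y)) * k u)).
    under eq_Rintegral do rewrite E.
    rewrite RintegralD//; [|exact: integrableRZl|exact: integrableRZl].
    by rewrite !RintegralZl// -/(cosT k t) -/(sinT k t); ring.
  rewrite -[RHS](Rintegral_shift y).
    by apply: eq_Rintegral => x _; rewrite subrK.
  apply: integrableR_eq (fun u => esym (E u)) _.
  by apply: integrableRD; exact: integrableRZl.
have icf := integrable_cosM if_ t; have isf := integrable_sinM if_ t.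
rewrite !charfunE; apply/eqP; rewrite eq_complex /=; apply/andP; split; apply/eqP.
- have [_ ] := conv_fubini ik if_ (measurable_cos_mul t) kM (fun x => cos_max _).
  rewrite -/(cosT _ _) => ->.
  transitivity (\int[leb]_y (cosT k t * (cos (t * y) * f y) - sinT k t * (sin (t * y) * f y))).
    by apply: eq_Rintegral => y _; rewrite shiftc; ring.
  by rewrite RintegralB ?RintegralZl//; exact: integrableRZl.
- have [_ ] := conv_fubini ik if_ (measurable_sin_mul t) kM (fun x => sin_max _).
  rewrite -/(sinT _ _) => ->.
  transitivity (\int[leb]_y (cosT k t * (sin (t * y) * f y) + sinT k t * (cos (t * y) * f y))).
    by apply: eq_Rintegral => y _; rewrite shifts; ring.
  by rewrite RintegralD ?RintegralZl//; exact: integrableRZl.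
Qed.

Lemma charfun_Kh (K : R -> R) (h t : R) : leb.-integrable setT (EFin \o K) -> 0 < h ->
  charfun (Kh K h) t = charfun K (h * t).
Proof.
move=> iK h0; have hV : h^-1 != 0 by rewrite invr_eq0 gt_eqF.
have E x : h * t * (h^-1 * x + 0) = t * x.
  by rewrite addr0; field; rewrite gt_eqF.
rewrite !charfunE; congr (_ +i* _)%C.
- have ic := integrable_cosM iK (h * t).
  rewrite /cosT [RHS](Rintegral_affine 0 hV ic) gtr0_norm ?invr_gt0// -RintegralZl//.
    by apply: eq_Rintegral => x _; rewrite KhE E mulrCA.
  exact: (integrable_affine 0 hV ic).
- have ic := integrable_sinM iK (h * t).
  rewrite /sinT [RHS](Rintegral_affine 0 hV ic) gtr0_norm ?invr_gt0// -RintegralZl//.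
    by apply: eq_Rintegral => x _; rewrite KhE E mulrCA.
  exact: (integrable_affine 0 hV ic).
Qed.

(** Equality at nonnegative [t] extends to all [t] because the cosine transform is even and the sine
    transform odd; then [fourier_unique] applies to [u - v]. *)
Lemma eq_charfun_ae (u v : R -> R) :
  leb.-integrable setT (EFin \o u) -> leb.-integrable setT (EFin \o v) ->
  (forall t, 0 <= t -> charfun u t = charfun v t) ->
  {ae leb, forall x, u x - v x = 0}.
Proof.
move=> iu iv uv.
have E t : 0 <= t -> cosT u t = cosT v t /\ sinT u t = sinT v t.
  by move=> /uv; rewrite !charfunE => -[].
have E' t : cosT u t = cosT v t /\ sinT u t = sinT v t.
  have [/E//|t0] := leP 0 t.
  have [] := E (- t); first by rewrite oppr_ge0 ltW.
  by rewrite !cosTN sinTN// sinTN// => -> /oppr_inj ->.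
apply: (@fourier_unique _ (fun x => u x - v x)); first exact: integrableRB.
- move=> t; have [+ _] := E' t; rewrite /cosT => {}E'.
  under eq_Rintegral do rewrite mulrBr.
  by rewrite RintegralB ?E' ?subrr//; exact: integrable_cosM.
- move=> t; have [_ +] := E' t; rewrite /sinT => {}E'.
  under eq_Rintegral do rewrite mulrBr.
  by rewrite RintegralB ?E' ?subrr//; exact: integrable_sinM.
Qed.

End CharFun.

(** * Limits of bandwidths *)

Section WeakLimit.
Local Open Scope classical_set_scope.
Variable R : realType.
Local Notation leb := (@lebesgue_measure R).

(** A weighted form of Cauchy-Schwarz without square roots: pointwise, the right side minus |g d| is
    a square over [l] plus |g d|. *)
Lemma cauchy_schwarz_eps (g d : R -> R) (l : R) : 0 < l ->
  leb.-integrable setT (EFin \o (fun x => g x * d x)) ->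
  leb.-integrable setT (EFin \o (fun x => g x ^+ 2)) ->
  leb.-integrable setT (EFin \o (fun x => d x ^+ 2)) ->
  `|\int[leb]_x (g x * d x)| <=
    l * \int[leb]_x (g x ^+ 2) + l^-1 * \int[leb]_x (d x ^+ 2).
Proof.
move=> l0 igd ig2 id2.
rewrite (le_trans (le_normr_Rintegral _ igd))//.
have i1 := integrableRZl l ig2; have i2 := integrableRZl l^-1 id2.
rewrite -!RintegralZl// -RintegralD//.
apply: le_Rintegral => //; [exact: integrable_norm|exact: integrableRD|].
move=> x _; rewrite normrM -[g x ^+ 2]real_normK ?num_real// -[d x ^+ 2]real_normK ?num_real//.
set a := `|g x|; set b := `|d x|.
have ab0 : 0 <= a * b by apply: mulr_ge0; exact: normr_ge0.
rewrite -subr_ge0.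
have -> : l * a ^+ 2 + l^-1 * b ^+ 2 - a * b =
    l^-1 * (l * a - b) ^+ 2 + a * b by field; rewrite gt_eqF.
by rewrite addr_ge0// mulr_ge0 ?sqr_ge0// invr_ge0 ltW.
Qed.

Lemma sqnorm_integrable (d : R -> R) : measurable_fun setT d ->
  (sqnorm d < +oo)%E -> leb.-integrable setT (EFin \o (fun x => d x ^+ 2)).
Proof.
move=> md dfin; apply/integrableP; split.
  by apply/measurable_EFinP; exact: measurable_funX.
by under eq_integral do rewrite /= ger0_norm ?sqr_ge0//.
Qed.

Variables (K f : R -> R).
Hypothesis kK : is_kernel K.
Hypothesis df : prob_density f.

Let iK := kernel_integrable kK.
Let if_ := density_integrable df.

Lemma conv_Kh_integrable h : 0 < h ->
  leb.-integrable setT (EFin \o conv (Kh K h) f).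
Proof.
move=> h0; have [M _ KM] := kernel_bound kK.
exact: conv_integrable (Kh_integrable iK h0) if_ (fun x => Kh_bound KM x h0).
Qed.

(** The substitution x = y + h u moves the bandwidth from [K] into the test function, whose
    continuity can then be used. *)
Lemma conv_Kh_test (g : R -> R) (h : R) : 0 < h -> measurable_fun setT g ->
  (forall x, `|g x| <= 1) ->
  \int[leb]_x (g x * conv (Kh K h) f x) =
  \int[leb]_y (f y * \int[leb]_u (g (y + h * u) * K u)).
Proof.
move=> h0 mg g1; have [M _ KM] := kernel_bound kK.
have iKh := Kh_integrable iK h0; have KhM x := Kh_bound KM x h0.
have [_ ->] := conv_fubini iKh if_ mg KhM g1.
apply: eq_Rintegral => y _; rewrite mulrC; congr (_ * _).
have hn : h != 0 by rewrite gt_eqF.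
have iF : leb.-integrable setT (EFin \o (fun x => g x * Kh K h (x - y))).
  by apply: (integrable_bounded _ mg g1); exact: integrable_shift.
rewrite (Rintegral_affine y hn iF) gtr0_norm// -RintegralZl//; last first.
  exact: (integrable_affine y hn iF).
apply: eq_Rintegral => u _; rewrite addrK /Kh (addrC _ y).
by rewrite (_ : h * u / h = u); field.
Qed.

(** Dominated convergence twice: |K| dominates the inner integrand, |f| ||K||_1 the outer one. *)
Lemma conv_Kh_test_cvg (g : R -> R) (r : nat -> R) (h : R) : 0 < h ->
  (forall n, 0 < r n) -> r n @[n --> \oo] --> h ->
  continuous g -> (forall x, `|g x| <= 1) ->
  \int[leb]_x (g x * conv (Kh K (r n)) f x) @[n --> \oo] -->
  \int[leb]_x (g x * conv (Kh K h) f x).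
Proof.
move=> h0 r0 rh cg g1; have mg := continuous_measurable_fun cg.
have mphi (s : R) : measurable_fun setT (fun z : R * R => g (z.1 + s * z.2)).
  apply: (measurableT_comp mg); apply: measurable_funD; first exact: measurable_fst.
  by apply: measurable_funM => //; exact: measurable_snd.
have mgs (s y : R) : measurable_fun setT (fun u : R => g (y + s * u)).
  exact: (measurable_fun_pair2 y (mphi s)).
rewrite conv_Kh_test//; under eq_fun do rewrite conv_Kh_test//.
have iaK := integrable_norm iK.
apply: (@Rintegral_cvg R (fun n y => f y * \int[leb]_u (g (y + r n * u) * K u)) _
  (fun y => `|f y| * \int[leb]_u `|K u|)).
- move=> n; have [+ _] := Rintegral_fubini_prod if_ iK (mphi (r n)) (fun z => g1 _).
  exact: integrableR_measurable.
- move=> y; apply: cvgMr.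
  apply: (@Rintegral_cvg R (fun n u => g (y + r n * u) * K u) _ (fun u => `|K u|)) => //.
  + by move=> n; apply: measurable_funM => //; exact: integrableR_measurable.
  + move=> u; apply: cvgMl.
    have H : y + r n * u @[n --> \oo] --> y + h * u.
      by apply: cvgD; [exact: cvg_cst|exact: cvgMl].
    exact: (cvg_comp _ _ H (cg _)).
  + by move=> n u; rewrite normrM ler_piMl.
- by apply: integrableRZr; exact: integrable_norm.
- move=> n y; rewrite normrM ler_wpM2l//.
  have iu : leb.-integrable setT (EFin \o (fun u => g (y + r n * u) * K u)).
    by apply: (integrable_bounded iK (mgs _ _)).
  rewrite (le_trans (le_normr_Rintegral _ iu))//.
  apply: le_Rintegral => //; first exact: integrable_norm.
  by move=> u _; rewrite normrM ler_piMl.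
Qed.

(** Both sides are limits of the same sequence: one by continuity in the bandwidth, the other
    because the bias tends to 0 and [g] is square integrable. *)
Lemma conv_Kh_test_eq (g : R -> R) (r b : nat -> R) (h : R) : 0 < h ->
  (forall n, 0 < r n) -> r n @[n --> \oo] --> h ->
  (forall n, (bias K f (r n) <= (b n)%:E)%E) -> b n @[n --> \oo] --> (0 : R) ->
  continuous g -> (forall x, `|g x| <= 1) ->
  leb.-integrable setT (EFin \o (fun x => g x ^+ 2)) ->
  \int[leb]_x (g x * conv (Kh K h) f x) = \int[leb]_x (g x * f x).
Proof.
move=> h0 r0 rh rb b0 cg g1 ig2; have mg := continuous_measurable_fun cg.
have mf := integrableR_measurable if_.
have L := conv_Kh_test_cvg h0 r0 rh cg g1.
suff L' : \int[leb]_x (g x * conv (Kh K (r n)) f x) @[n --> \oo] -->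
    \int[leb]_x (g x * f x).
  by rewrite -(cvg_lim (@Rhausdorff R) L) (cvg_lim (@Rhausdorff R) L').
have igf : leb.-integrable setT (EFin \o (fun x => g x * f x)).
  exact: integrable_bounded g1.
have est n l : 0 < l -> `|\int[leb]_x (g x * f x) -
    \int[leb]_x (g x * conv (Kh K (r n)) f x)| <=
    l * \int[leb]_x (g x ^+ 2) + l^-1 * b n.
  move=> l0; have ic := conv_Kh_integrable (r0 n).
  have md : measurable_fun setT (fun x => conv (Kh K (r n)) f x - f x).
    by apply: measurable_funB => //; exact: integrableR_measurable.
  have igc : leb.-integrable setT (EFin \o (fun x => g x * conv (Kh K (r n)) f x)).
    exact: integrable_bounded g1.
  have id2 := sqnorm_integrable md (le_lt_trans (rb n) (ltry _)).
  have igd : leb.-integrable setT (EFin \o (fun x => g x * (conv (Kh K (r n)) f x - f x))).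
    by apply: integrable_bounded g1 => //; exact: integrableRB.
  rewrite distrC -RintegralB//; under eq_Rintegral do rewrite -mulrBr.
  rewrite (le_trans (cauchy_schwarz_eps l0 igd ig2 id2))// lerD2l ler_wpM2l ?invr_ge0 ?(ltW l0)//.
  by rewrite -lee_fin EFin_Rintegral//; exact: rb.
set G := \int[leb]_x (g x ^+ 2) in est.
have G0 : 0 <= G by apply: Rintegral_ge0 => x _; exact: sqr_ge0.
apply/cvgrPdist_le => e e0.
(* This makes the first term of the estimate at most e / 2; the second then falls below e / 2 for
   large [n]. *)
pose l := e / (2 * (G + 1)).
have G1 : 0 < G + 1 by rewrite ltr_wpDl.
have l0 : 0 < l by rewrite divr_gt0// mulr_gt0.
have lG : l * G <= e / 2.
  have -> : l * G = e / 2 * (G / (G + 1)) by rewrite /l; field; rewrite gt_eqF.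
  have e20 : 0 <= e / 2 by rewrite divr_ge0// ltW.
  by rewrite ler_piMr// ler_pdivrMr// mul1r lerDl.
near=> n.
rewrite (le_trans (est n l l0))// [leRHS]splitr lerD// mulrC ler_pdivrMr//.
by near: n; apply: (cvgr_le _ b0); rewrite mulr_gt0// divr_gt0.
Unshelve. all: by end_near. Qed.

(** A continuous cutoff supported in [-N, N], which makes bounded continuous test functions square
    integrable. *)
Definition tent (N x : R) : R := Num.max 0 (1 - `|x| / N).

Lemma continuous_tent N : continuous (tent N).
Proof.
move=> x; apply: (@continuous_max _ _ (fun=> 0) (fun x : R => 1 - `|x| / N)).
  exact: cvg_cst.
by apply: cvgB; [exact: cvg_cst|apply: cvgMl; exact: norm_continuous].
Qed.

Lemma tent_bound N x : 0 < N -> 0 <= tent N x <= 1.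
Proof.
move=> N0; rewrite /tent le_max lexx/= ge_max ler01/= gerBl divr_ge0// ltW//.
Qed.

Lemma cvg_tent x : tent n.+1%:R x @[n --> \oo] --> (1 : R).
Proof.
rewrite -[X in _ --> X](_ : Num.max 0 (1 - 0) = 1); last first.
  by rewrite subr0; apply/max_idPr.
have H : 1 - `|x| / n.+1%:R @[n --> \oo] --> (1 - 0 : R).
  apply: cvgB; first exact: cvg_cst.
  rewrite -(mulr0 `|x|); apply: cvgMr; exact: cvg_harmonic.
by apply: cvg_comp H _; apply: (@continuous_max _ _ (fun=> 0) id); [exact: cvg_cst|exact: cvg_id].
Qed.

(** Cut [e] off by tents, apply [conv_Kh_test_eq], and let the tents widen; both integrals pass to
    the limit by dominated convergence. *)
Lemma conv_Kh_test_eq_bounded (e : R -> R) (r b : nat -> R) (h : R) : 0 < h ->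
  (forall n, 0 < r n) -> r n @[n --> \oo] --> h ->
  (forall n, (bias K f (r n) <= (b n)%:E)%E) -> b n @[n --> \oo] --> (0 : R) ->
  continuous e -> (forall x, `|e x| <= 1) ->
  \int[leb]_x (e x * conv (Kh K h) f x) = \int[leb]_x (e x * f x).
Proof.
move=> h0 r0 rh rb b0 ce e1.
have me := continuous_measurable_fun ce.
have E n : \int[leb]_x (e x * tent n.+1%:R x * conv (Kh K h) f x) =
    \int[leb]_x (e x * tent n.+1%:R x * f x).
  have ceg : continuous (fun x => e x * tent n.+1%:R x).
    by move=> x; apply: cvgM; [exact: ce|exact: continuous_tent].
  apply: (conv_Kh_test_eq h0 r0 rh rb b0 ceg).
  - move=> x; have /andP[t0 t1] := @tent_bound n.+1%:R x (ltr0Sn _ _).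
    by rewrite normrM (ger0_norm t0) mulr_ile1.
  - apply: integrableR_eq _ (@continuous_integrable_itv R
      (fun x => (e x * tent n.+1%:R x) ^+ 2) (- n.+1%:R) n.+1%:R _).
      move=> x; rewrite indicE; case: (boolP (x \in _)) => [_|]; first by rewrite mul1r.
      rewrite mul0r notin_setE/= in_itv/= -ler_norml => /negP; rewrite -ltNge => nx.
      rewrite (_ : tent _ _ = 0) ?mulr0 ?expr0n//.
      by apply/max_idPl; rewrite subr_le0 ler_pdivlMr// mul1r ltW.
    by move=> x; apply: cvgM; exact: ceg.
have lim (d : R -> R) : leb.-integrable setT (EFin \o d) ->
    \int[leb]_x (e x * tent n.+1%:R x * d x) @[n --> \oo] --> \int[leb]_x (e x * d x).
  move=> id_; have md := integrableR_measurable id_.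
  apply: (@Rintegral_cvg R (fun n x => e x * tent n.+1%:R x * d x) _ (fun x => `|d x|)).
  - move=> n; apply: measurable_funM => //; apply: measurable_funM => //.
    by apply: continuous_measurable_fun; exact: continuous_tent.
  - move=> x; apply: cvgMl; rewrite -[X in _ --> X]mulr1; apply: cvgMr; exact: cvg_tent.
  - exact: integrable_norm.
  - move=> n x; have /andP[t0 t1] := @tent_bound n.+1%:R x (ltr0Sn _ _).
    by rewrite normrM ler_piMl// normrM (ger0_norm t0) mulr_ile1.
have lc := lim _ (conv_Kh_integrable h0); have lf := lim _ if_.
rewrite -(cvg_lim (@Rhausdorff R) lc) -(cvg_lim (@Rhausdorff R) lf).
by congr (limn _); apply/funext => n; exact: E.
Qed.

(** The test functions are cos (t x) and sin (t x), bounded but not square integrable. *)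
Lemma charfun_of_bias_cvg0 (r b : nat -> R) (h t : R) : 0 < h ->
  (forall n, 0 < r n) -> r n @[n --> \oo] --> h ->
  (forall n, (bias K f (r n) <= (b n)%:E)%E) -> b n @[n --> \oo] --> (0 : R) ->
  charfun K (h * t) * charfun f t = charfun f t.
Proof.
move=> h0 r0 rh rb b0; have [M _ KM] := kernel_bound kK.
have iKh := Kh_integrable iK h0; have KhM x := Kh_bound KM x h0.
rewrite -charfun_Kh// -(charfun_conv t iKh if_ KhM).
have T := conv_Kh_test_eq_bounded h0 r0 rh rb b0.
rewrite !charfunE; congr (_ +i* _)%C; apply: T.
- move=> x; apply: (@continuous_comp _ _ _ (fun x : R => t * x) cos); last exact: continuous_cos.
  exact: mulrl_continuous.
- by move=> x; exact: cos_max.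
- move=> x; apply: (@continuous_comp _ _ _ (fun x : R => t * x) sin); last exact: continuous_sin.
  exact: mulrl_continuous.
- by move=> x; exact: sin_max.
Qed.

Lemma bias_eq0 (h : R) : 0 < h ->
  (forall t, 0 <= t -> charfun K (h * t) * charfun f t = charfun f t) ->
  bias K f h = 0%E.
Proof.
move=> h0 H; have [M _ KM] := kernel_bound kK.
have iKh := Kh_integrable iK h0; have KhM x := Kh_bound KM x h0.
have ic := conv_Kh_integrable h0.
have ae0 : {ae leb, forall x, conv (Kh K h) f x - f x = 0}.
  apply: eq_charfun_ae => // t t0.
  by rewrite (charfun_conv t iKh if_ KhM) charfun_Kh// H.
rewrite /bias /sqnorm (@ae_eq_integral _ _ _ leb setT (cst 0%E))//.
- exact: integral0.
- apply/measurable_EFinP; apply: measurable_funX; apply: measurable_funB; exact: integrableR_measurable.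
- move: ae0; apply: filterS; first exact: (ae_filter_ringOfSetsType leb).
  by move=> x /= -> _; rewrite expr0n.
Qed.

End WeakLimit.

(** * The two directions of the equivalence *)

Section Theorem4.
Local Open Scope classical_set_scope.
Variable R : realType.
Local Notation leb := (@lebesgue_measure R).
Variables (K f : R -> R).
Hypothesis kK : is_kernel K.
Hypothesis L2K : L2 K.
Hypothesis df : prob_density f.
Hypothesis L2f : L2 f.

Let iK := kernel_integrable kK.
Let if_ := density_integrable df.

Lemma limit_bandwidth : exact_order_inv_n (fun n => Phi n f K) ->
  exists2 h : R, 0 < h & forall t, charfun K (h * t) * charfun f t = charfun f t.
Proof.
move=> [c [C [c0 cC [n0 H]]]].
have C0 : 0 < C by exact: lt_le_trans cC.
have C1 : 0 < C + 1 by rewrite ltr_wpDl// ltW.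
have np n : 0 < n.+1%:R :> R by [].
(* Relaxing [C] to [C + 1] makes the bound on the infimum strict, so some bandwidth meets it; the
   shift by [n0] puts every index in the range of the hypothesis. *)
have /choice[h Hh] : forall n, exists h : R, 0 < h /\
    (MISE (n0 + n).+1 f K h <= ((C + 1) / (n0 + n).+1%:R)%:E)%E.
  move=> n; have [|_ HC] := H (n0 + n).+1 _ (ltn0Sn _).
    by rewrite (leq_trans (leq_addr n n0)).
  have : (Phi (n0 + n).+1 f K < ((C + 1) / (n0 + n).+1%:R)%:E)%E.
    by rewrite (le_lt_trans HC)// lte_fin ltr_pM2r ?invr_gt0// ltrDl.
  by move=> /ereal_inf_lt[_ [h /= h0 <-] /ltW hC]; exists h.
have h_gt0 n : 0 < h n by have [] := Hh n.
have HB n : (bias K f (h n) <= ((C + 1) / (n0 + n).+1%:R)%:E)%E.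
  have [hn] := Hh n; rewrite MISE_decomposition//; apply: le_trans.
  by rewrite leeDl// mule_ge0 ?variance_ge0// lee_fin invr_ge0 ltW.
have HV n : (variance K f (h n) <= (C + 1)%:E)%E.
  have [hn] := Hh n; rewrite MISE_decomposition// => HM.
  have : ((n0 + n).+1%:R^-1%:E * variance K f (h n) <= ((C + 1) / (n0 + n).+1%:R)%:E)%E.
    by apply: le_trans HM; rewrite leeDr// bias_ge0.
  move=> /(lee_wpmul2l (_ : (0 <= (n0 + n).+1%:R%:E)%E)).
  rewrite lee_fin => /(_ (ltW (np _))).
  by rewrite muleA -!EFinM mulfV ?gt_eqF// mul1e mulrC divfK ?gt_eqF.
(* [C + 2] exceeds the bound [C + 1] on the variances, so no [h n] can be as small as [hl]. *)
have [hl hl0 Hl] := variance_near0 kK L2K df L2f (C + 2).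
have hl_le n : hl <= h n.
  rewrite leNgt; apply/negP => /ltW hn.
  have := le_trans (Hl _ (h_gt0 n) hn) (HV n).
  by rewrite lee_fin; lra.
have [hu [b [hu0 b0 Hu]]] := bias_far kK df.
pose B n : R := (C + 1) / (n0 + n).+1%:R.
have cB : B n @[n --> \oo] --> (0 : R).
  rewrite -(mulr0 (C + 1)); apply: cvgMr.
  have := @cvg_harmonic R; rewrite -(cvg_shiftn n0).
  by under eq_fun do rewrite addnC.
(* Once B n < b, a bandwidth of at least [hu] would have too large a bias. *)
have hF : \forall n \near \oo, (`[hl, hu]%classic : set R) (h n).
  have : \forall n \near \oo, B n < b by exact: (cvgr_lt _ cB).
  apply: filterS => n Bn; rewrite /= in_itv/= hl_le/=.
  rewrite leNgt; apply/negP => /ltW hun.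
  have := le_trans (Hu _ hun) (HB n).
  by rewrite lee_fin leNgt Bn.
have [p [/= + clp]] := @segment_compact R hl hu (h n @[n --> \oo]) _ hF.
rewrite in_itv/= => /andP[hlp _].
have [s s_incr hs] := (cluster_eventually_cvg h p).1 clp.
have p0 : 0 < p by exact: lt_le_trans hlp.
exists p => // t.
have := @charfun_of_bias_cvg0 R K f kK df (h \o s) (B \o s) p t p0.
apply.
- by move=> n; exact: h_gt0.
- exact: hs.
- by move=> n; exact: HB.
(* A strictly increasing [s] dominates the identity, so the bound still tends to 0 along the
   subsequence. *)
- have ge_s n : (n <= s n)%N.
    elim: n => // n IH; apply: leq_ltn_trans IH _.
    by move/increasing_seqP : s_incr => /(_ n).
  apply: cvg_comp cB => A [N _ NA]; exists N => // n /= Nn.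
  by apply: NA => /=; exact: leq_trans (ge_s n).
Qed.

Lemma charfun_lt_S_K (t : R) : 0 <= t -> (t%:E < S_K K)%E -> charfun K t = 1.
Proof.
move=> t0 tS; apply/eqP; apply: contraLR tS => Kt; rewrite -leNgt.
by apply: ereal_inf_lbound; exists t => //; split=> //; rewrite charfun_neq1.
Qed.

Lemma exact_order_S_K_D_f : S_K K = T_K K ->
  exact_order_inv_n (fun n => Phi n f K) -> (0 < S_K K)%E /\ (D_f f < +oo)%E.
Proof.
move=> ST /limit_bandwidth[h h0 E].
have K1 t : charfun f t != 0 -> charfun K (h * t) = 1.
  by move=> ft; apply: (mulIf ft); rewrite E mul1r.
have f0 : charfun f 0 != 0.
  rewrite charfunE eq_complex negb_and /= /cosT.
  under eq_Rintegral do rewrite mul0r cos0 mul1r.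
  by rewrite density_Rintegral// oner_eq0.
have S1 := @charfun_lt_S_K.
split.
  (* The transform of [f] is nonzero on [0, d), so that of [K] is 1 on [0, h d), and [h * d] is a
     lower bound for [S_K]. *)
  have [d d0 Hd] := charfun_near_neq0 if_ f0.
  apply: (@lt_le_trans _ _ (h * d)%:E); first by rewrite lte_fin mulr_gt0.
  apply: le_ereal_inf_tmp => _ [t [t0 +] <-]; rewrite charfun_neq1 lee_fin.
  apply: contraNT; rewrite -ltNge => td; apply/eqP.
  rewrite -(K1 (t / h)); first by congr charfun; field; rewrite gt_eqF.
  apply: Hd; rewrite sub0r normrN ger0_norm ?divr_ge0 ?(ltW h0)//.
  by rewrite ltr_pdivrMr// mulrC.
(* Otherwise the transform of [K] is 1 on the whole half-line, and the bias vanishes even at large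
   bandwidths, against [bias_far]. *)
have Slt : (T_K K < +oo)%E.
  rewrite -ST ltey; apply/negP => /eqP Soo.
  have [hu [b [hu0 b0 Hu]]] := bias_far kK df.
  have := Hu hu (lexx _); rewrite bias_eq0// ?lee_fin ?leNgt ?b0// => t t0.
  by rewrite S1 ?mul1r ?Soo ?ltry// mulr_ge0// ltW.
have [_ [r [r0 rae] <-] _] := ereal_inf_lt Slt.
apply: (@le_lt_trans _ _ (r / h)%:E); last exact: ltry.
apply: ge_ereal_sup => _ [t [t0 ft] <-]; rewrite lee_fin leNgt; apply/negP => rt.
have [d d0 Hd] := charfun_near_neq0 if_ ft.
(* The transform of [f] is nonzero on ]t, t + d[, so that of [K] is 1 on [J]. As [J] lies beyond [r]
   it must be null, against its length h d. *)
pose J : set (measurableTypeR R) := `]h * t, h * (t + d)[%classic.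
have mJ : measurable J by exact: measurable_itv.
have J0 : leb J = 0%E.
  apply: (measure_negligible mJ); apply: negligibleS rae => s.
  rewrite /J/= in_itv/= => /andP[ts sd] /(_ _).
  have rs : r <= s.
    by rewrite (le_trans _ (ltW ts))// mulrC -ler_pdivrMr// ltW.
  move=> /(_ rs); rewrite charfun_neq1 => /eqP; apply.
  rewrite -(K1 (s / h)); first by congr charfun; field; rewrite gt_eqF.
  apply: Hd; rewrite distrC gtr0_norm ?subr_gt0 ?ltr_pdivlMr ?(mulrC t)//.
  by rewrite ltrBlDl ltr_pdivrMr// mulrC.
move: J0; rewrite lebesgue_measure_itv/= lte_fin ltr_pM2l// ltrDl d0 -EFinD => -[].
by rewrite mulrDr addrC addKr => /eqP; rewrite gt_eqF// mulr_gt0.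
Qed.

Lemma S_K_D_f_exact_order : (0 < S_K K)%E -> (D_f f < +oo)%E ->
  exact_order_inv_n (fun n => Phi n f K).
Proof.
move=> S0 Dlt.
have S1 := @charfun_lt_S_K.
have [s s0 sS] : exists2 s : R, 0 < s & (s%:E < S_K K)%E.
  case: (S_K K) S0 => [r|//|//].
    rewrite lte_fin => r0; exists (r / 2); first by rewrite divr_gt0.
    by rewrite lte_fin ltr_pdivrMr// mulr_natr mulr2n ltrDl.
  by move=> _; exists 1 => //; rewrite ltry.
(* The maximum with 1 keeps [D] positive for the division defining [h]. *)
have [D D0 DD] : exists2 D : R, 0 < D & (D_f f <= D%:E)%E.
  case: (D_f f) Dlt => [r _|//|_].
    by exists (Num.max 1 r); rewrite ?lt_max ?ltr01// lee_fin le_max lexx orbT.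
  by exists 1 => //; exact: leNye.
(* Where the transform of [f] is nonzero, t <= D and so h t <= s < S_K. *)
pose h := s / D.
have h0 : 0 < h by rewrite divr_gt0.
have B0 : bias K f h = 0%E.
  apply: bias_eq0 => // t t0.
  have [->|ft] := eqVneq (charfun f t) 0; first by rewrite mulr0.
  have -> : charfun K (h * t) = 1; last by rewrite mul1r.
  apply: S1; first by rewrite mulr_ge0// ltW.
  apply: le_lt_trans sS.
  rewrite lee_fin /h mulrAC ler_pdivrMr// ler_pM2l// -lee_fin.
  by apply: le_trans DD; apply: ereal_sup_ubound; exists t.
have [c c0 Hc] := MISE_lower_bound kK L2K df L2f.
have [M _ KM] := kernel_bound kK.
(* By [totvarE] the variance is at most ||K_h||^2 = ||K||^2 / h. *)
have Vfin : variance K f h \is a fin_num.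
  rewrite ge0_fin_numE ?variance_ge0//.
  apply: (@le_lt_trans _ _ (sqnorm (Kh K h))).
    rewrite -(totvarE (Kh_integrable iK h0) (fun x => Kh_bound KM x h0) df).
    by rewrite leeDl// sqnorm_ge0.
  rewrite (sqnorm_Kh iK h0) lte_mul_pinfty ?lee_fin ?invr_ge0 ?(ltW h0)//.
  by case: L2K.
have V0 : 0 <= fine (variance K f h) by rewrite fine_ge0// variance_ge0.
(* Adding [c] to the variance only ensures that the upper constant is at least the lower one. *)
exists c, (c + fine (variance K f h)); split => //; first by rewrite lerDl.
exists 0%N => n _ n0; split.
  by apply: le_ereal_inf_tmp => _ [t t0 <-]; exact: Hc.
apply: (@le_trans _ _ (MISE n f K h)); first by apply: ereal_inf_lbound; exists h.
rewrite MISE_decomposition// B0 add0e -(fineK Vfin) -EFinM lee_fin mulrC.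
by rewrite ler_wpM2r ?invr_ge0// lerDr ltW.
Qed.

End Theorem4.

Unset Implicit Arguments.

Theorem theorem4 (R : realType) (K f : R -> R) :
  is_kernel K -> L2 K -> S_K K = T_K K ->
  prob_density f -> L2 f ->
  (exact_order_inv_n (fun n => Phi n f K) <->
   ((0 < S_K K)%E /\ (D_f f < +oo)%E)).
Proof.
move=> kK L2K ST df L2f; split; first exact: exact_order_S_K_D_f.
by case; exact: S_K_D_f_exact_order.
Qed.
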